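(* Let $n\ge2$ and let $p>q\ge1$ be integers. Let $$K_{p+1,q+1}^n(z,u)=c_{p+1,q+1}\langle z,u\rangle^{p-q}\langle z,z\rangle^{q+1}\langle u,u\rangle^{q+1}P_{q+1}^{n-2,p-q}(2s-1)$$ be the harmonic kernel. If $\partial_{\underline{z}}^\dagger\partial_{\underline{z}}$ is applied from the left and $\partial_{\underline{u}}^\dagger\partial_{\underline{u}}$ from the right, one gets \begin{align*} \partial_{\underline{z}}^\dagger\partial_{\underline{z}} K_{p+1,q+1}^n\partial_{\underline{u}}^\dagger\partial_{\underline{u}}=\;&c_{p+1,q+1}(p+1)(n+p+q+1)\langle z,u\rangle ^{p-q-1}\langle z,z\rangle ^{q-1}\langle u,u\rangle ^{q-1}\\ \times\Big(&\langle z,u\rangle \langle z,z\rangle \langle u,u\rangle (\beta+p)(n-\beta+q)P_{q}^{n-1,p-q}\\ &-\langle z,u\rangle \langle u,u\rangle\, p(\beta+p)\,\underline{z}\wedge\underline{z}^\dagger\, P_{q-1}^{n,p-q}-\langle z,u\rangle \langle z,z\rangle\, p(\beta+p)\,\underline{u}\wedge \underline{u}^\dagger\, P_{q-1}^{n,p-q}\\ &-\langle z,u\rangle ^2(n+p)(\beta+p)\,\underline{z}^\dagger\underline{u}\, P_{q-1}^{n,p-q+1}-\langle z,z\rangle \langle u,u\rangle\, p(n-\beta+q)\,\underline{z}\,\underline{u}^\dagger\, P_{q}^{n,p-q-1}\\ &+\langle z,u\rangle\, p(n+p+q)\,\underline{z}\,\underline{z}^\dagger\underline{u}\,\underline{u}^\dagger\,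 P_{q-1}^{n,p-q}\Big), \end{align*} where all Jacobi polynomials are evaluated at $2s-1$ with $s=\frac{\langle z,u\rangle\overline{\langle z,u\rangle}}{\langle z,z\rangle\langle u,u\rangle}$.
   Context: $\mathbb{C}_{2n}$ is the complex Clifford algebra generated by $e_1,\dots,e_{2n}$ with $e_je_k+e_ke_j=-2\delta_{jk}$. The Witt basis is $f_j=\frac12(e_j-ie_{n+j})$, $f_j^\dagger=-\frac12(e_j+ie_{n+j})$, $j=1,\dots,n$; it satisfies $f_jf_k+f_kf_j=0=f_j^\dagger f_k^\dagger+f_k^\dagger f_j^\dagger$, $f_jf_k^\dagger+f_k^\dagger f_j=\delta_{jk}$. For $z\in\mathbb{C}^n\cong\mathbb{R}^{2n}$, $z_j=x_j+ix_{n+j}$ (similarly $u\in\mathbb{C}^n$): $\langle z,u\rangle=\sum_{j=1}^nz_j\bar u_j$, $\underline{z}=\sum_jf_jz_j$, $\underline{z}^\dagger=\sum_jf_j^\dagger\bar z_j$, $\partial_{\underline{z}}=\sum_jf_j^\dagger\partial_{z_j}$, $\partial_{\underline{z}}^\dagger=\sum_jf_j\bar\partial_{z_j}$, with $\partial_{z_j}=\frac12(\partial_{x_j}-i\partial_{x_{n+j}})$, $\bar\partial_{z_j}=\frac12(\partial_{x_j}+i\partial_{x_{n+j}})$; analogously for $u$. Acting from the right, $g\,\partial_{\underline{u}}=\sum_j(\partial_{u_j}g)f_j^\dagger$, $g\,\partial_{\underline{u}}^\dagger=\sum_j(\bar\partial_{u_j}g)f_j$, and $g\,\partial_{\underline{u}}^\dagger\partial_{\underline{u}}=(g\,\partial_{\underline{u}}^\dagger)\partial_{\underline{u}}$.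 $\beta=\sum_{j=1}^nf_j^\dagger f_j\in\mathbb{C}_{2n}$. The wedge of two vectors is $a\wedge b=\frac12(ab-ba)$. $P_k^{a,b}$ denotes the Jacobi polynomial $P_k^{a,b}(x)=\frac{\Gamma(a+k+1)}{k!\,\Gamma(a+b+k+1)}\sum_{j=0}^k\binom kj\frac{\Gamma(a+b+k+j+1)}{\Gamma(a+j+1)}\big(\frac{x-1}2\big)^j$. The constant is $c_{p,q}=\frac{n-1+p+q}{n-1}\binom{n-2+p}{p}$ for $p\ge q$, so that $K^n_{p,q}(z,u)=c_{p,q}\langle z,u\rangle^{p-q}\langle z,z\rangle^q\langle u,u\rangle^qP_q^{n-2,p-q}(2s-1)$ is the reproducing kernel on $\mathbb{S}^{2n-1}$ of harmonic polynomials of bidegree $(p,q)$ in $(z,\bar z)$. *)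

(* Defs.v *)
From HB Require Import structures.
From mathcomp Require Import all_boot all_order all_algebra.
From mathcomp Require Import ring complex reals normedtype derive.

Set Implicit Arguments.
Unset Strict Implicit.
Unset Printing Implicit Defensive.

Import Order.TTheory GRing.Theory Num.Theory.
Import numFieldNormedType.Exports.

Local Open Scope ring_scope.

(* The Clifford algebra over F with m generators e_j (j < m) and              *)
(*   e_j e_k + e_k e_j = -2 delta_jk.                                         *)
(* An element is the family of its coordinates in the basis                   *)
(*   e_A = e_(a1) ... e_(ar),  A = {a1 < ... < ar},                           *)
(* and e_A e_B = (-1)^(cl_inv A B) e_(A symdiff B): every pair b < a costs a  *)
(* transposition and every a in both A and B contributes e_a^2 = -1.          *)
Definition symd (T : finType) (A B : {set T}) : {set T} :=
  (A :\: B) :|: (B :\: A).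

Definition cl_inv (m : nat) (A B : {set 'I_m}) : nat :=
  (\sum_(a in A) \sum_(b in B) (b <= a))%N.

Definition clifford (F : Type) (m : nat) : Type := {ffun {set 'I_m} -> F}.

Section CliffordAlgebra.
Variables (F : comNzRingType) (m : nat).
Local Notation Cl := (clifford F m).
Implicit Types (A B C D : {set 'I_m}) (x y z : Cl).

HB.instance Definition _ := GRing.Lmodule.copy Cl {ffun {set 'I_m} -> F^o}.

Definition cl_basis A : Cl := [ffun B => (B == A)%:R].

Definition cl_one : Cl := cl_basis set0.

Definition cl_mul x y : Cl :=
  [ffun C => \sum_A \sum_(B | symd A B == C) (-1) ^+ cl_inv A B * (x A * y B)].

Definition cl_gen (j : 'I_m) : Cl := cl_basis [set j].

Lemma in_symd (a : 'I_m) A B : (a \in symd A B) = (a \in A) (+) (a \in B).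
Proof. by rewrite !inE; case: (a \in A); case: (a \in B). Qed.

Lemma symdC A B : symd A B = symd B A.
Proof. by apply/setP=> a; rewrite !in_symd addbC. Qed.

Lemma symdA A B C : symd A (symd B C) = symd (symd A B) C.
Proof. by apply/setP=> a; rewrite !in_symd addbA. Qed.

Lemma symdK A B : symd A (symd A B) = B.
Proof. by apply/setP=> a; rewrite !in_symd addbA addbb. Qed.

Lemma sym0d A : symd set0 A = A.
Proof. by apply/setP=> a; rewrite in_symd in_set0. Qed.

Lemma symdd A : symd A A = set0.
Proof. by apply/setP=> a; rewrite in_symd in_set0 addbb. Qed.

Lemma symd_eq A B C : (symd A B == C) = (B == symd A C).
Proof. by apply/eqP/eqP=> [<-|->]; rewrite symdK. Qed.

Lemma cl_invE A B :
  cl_inv A B = (\sum_a \sum_b [&& a \in A, b \in B & (b <= a)%N])%N.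
Proof.
rewrite /cl_inv big_mkcond; apply: eq_bigr => a _.
case: (a \in A); last by rewrite big1.
by rewrite big_mkcond; apply: eq_bigr => b _; case: (b \in B).
Qed.

Lemma odd_sum (I : finType) (f g h : I -> nat) :
  (forall i, odd (f i) = odd (g i) (+) odd (h i)) ->
  odd (\sum_i f i) = odd (\sum_i g i) (+) odd (\sum_i h i).
Proof.
move=> H; rewrite -oddD -big_split /=; elim: (index_enum I) => [|i s IH].
  by rewrite !big_nil.
by rewrite !big_cons !oddD IH H.
Qed.

Lemma cl_invDl A B C :
  (-1) ^+ cl_inv (symd A B) C = (-1) ^+ cl_inv A C * (-1) ^+ cl_inv B C :> F.
Proof.
rewrite -exprD -signr_odd -[RHS]signr_odd oddD !cl_invE; congr (_ ^+ nat_of_bool _).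
apply: odd_sum => a; apply: odd_sum => b.
by rewrite in_symd; case: (a \in A); case: (a \in B); case: (b \in C);
   case: (b <= a)%N.
Qed.

Lemma cl_invDr A B C :
  (-1) ^+ cl_inv A (symd B C) = (-1) ^+ cl_inv A B * (-1) ^+ cl_inv A C :> F.
Proof.
rewrite -exprD -signr_odd -[RHS]signr_odd oddD !cl_invE; congr (_ ^+ nat_of_bool _).
apply: odd_sum => a; apply: odd_sum => b.
by rewrite in_symd; case: (a \in A); case: (b \in B); case: (b \in C);
   case: (b <= a)%N.
Qed.

Lemma cl_addE x y A : (x + y) A = x A + y A.
Proof. by rewrite ffunE. Qed.

Lemma cl_scaleE (c : F) x A : (c *: x) A = c * x A.
Proof. by rewrite ffunE. Qed.

Lemma cl_mulE x y C :
  cl_mul x y C = \sum_A (-1) ^+ cl_inv A (symd A C) * (x A * y (symd A C)).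
Proof.
rewrite ffunE; apply: eq_bigr => A _.
by under eq_bigl do rewrite symd_eq; rewrite big_pred1_eq.
Qed.

Lemma cl_mulA : associative cl_mul.
Proof.
move=> x y z; apply/ffunP => D; rewrite !cl_mulE.
under [RHS]eq_bigr do rewrite cl_mulE mulr_suml mulr_sumr.
rewrite exchange_big /=; apply: eq_bigr => A _.
rewrite cl_mulE !mulr_sumr (reindex_inj (can_inj (symdK A))) /=.
apply: eq_bigr => C _.
have -> : symd (symd A C) (symd A D) = symd C D.
  by apply/setP=> a; rewrite !in_symd; case: (a \in A); rewrite ?addNb ?addbN ?negbK.
rewrite cl_invDl.
have -> : (-1) ^+ cl_inv A (symd A D)
  = (-1) ^+ cl_inv A (symd A C) * (-1) ^+ cl_inv A (symd C D) :> F.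
  by rewrite -cl_invDr; congr (_ ^+ cl_inv _ _);
     apply/setP=> a; rewrite !in_symd; case: (a \in A); case: (a \in C); case: (a \in D).
set s := (-1) ^+ cl_inv A (symd C D); set t := (-1) ^+ cl_inv A (symd A C).
set r := (-1) ^+ cl_inv C (symd C D).
have -> : t * s * (x A * (s * r * (y (symd A C) * z (symd C D))))
  = s * s * (r * (t * (x A * y (symd A C)) * z (symd C D))) by ring.
by rewrite /s -expr2 sqrr_sign mul1r.
Qed.

Lemma cl_basisM A B :
  cl_mul (cl_basis A) (cl_basis B) = (-1) ^+ cl_inv A B *: cl_basis (symd A B).
Proof.
apply/ffunP=> C; rewrite cl_mulE !ffunE (bigD1 A) //= big1 => [|D DA]; last first.
  by rewrite !ffunE (negPf DA) mul0r mulr0.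
rewrite !ffunE eqxx mul1r addr0 symd_eq.
by case: eqP => [->|_]; rewrite ?symdK // mulr0 scaler0.
Qed.

Lemma cl_mul1l : left_id cl_one cl_mul.
Proof.
move=> x; apply/ffunP=> C; rewrite cl_mulE (bigD1 set0) //= big1 => [|D D0].
  by rewrite sym0d /cl_inv big_set0 !ffunE eqxx !mul1r addr0.
by rewrite !ffunE (negPf D0) mul0r mulr0.
Qed.

Lemma cl_mul1r : right_id cl_one cl_mul.
Proof.
move=> x; apply/ffunP=> C; rewrite cl_mulE (bigD1 C) //= big1 => [|D DC].
  rewrite symdd /cl_inv big1 => [|a _]; last by rewrite big_set0.
  by rewrite !ffunE eqxx mulr1 mul1r addr0.
have -> : cl_one (symd D C) = 0.
  rewrite ffunE symd_eq symdC sym0d eq_sym; by rewrite (negPf DC).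
by rewrite !mulr0.
Qed.

Lemma cl_mulDl : left_distributive cl_mul +%R.
Proof.
move=> x y z; apply/ffunP=> C; rewrite cl_addE !cl_mulE -big_split /=.
by apply: eq_bigr => A _; rewrite cl_addE; ring.
Qed.

Lemma cl_mulDr : right_distributive cl_mul +%R.
Proof.
move=> x y z; apply/ffunP=> C; rewrite cl_addE !cl_mulE -big_split /=.
by apply: eq_bigr => A _; rewrite cl_addE; ring.
Qed.

Lemma cl_one_neq0 : cl_one != 0.
Proof.
by apply/eqP => /ffunP/(_ set0)/eqP; rewrite !ffunE eqxx oner_eq0.
Qed.

HB.instance Definition _ := GRing.Zmodule_isNzRing.Build Cl
  cl_mulA cl_mul1l cl_mul1r cl_mulDl cl_mulDr cl_one_neq0.

Lemma cl_scaleAl (c : F) x y : c *: (x * y) = (c *: x) * y.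
Proof.
apply/ffunP=> C; rewrite cl_scaleE !cl_mulE mulr_sumr.
by apply: eq_bigr => A _; rewrite cl_scaleE; ring.
Qed.

Lemma cl_scaleAr (c : F) x y : c *: (x * y) = x * (c *: y).
Proof.
apply/ffunP=> C; rewrite cl_scaleE !cl_mulE mulr_sumr.
by apply: eq_bigr => A _; rewrite cl_scaleE; ring.
Qed.

HB.instance Definition _ := GRing.Lmodule_isLalgebra.Build F Cl cl_scaleAl.
HB.instance Definition _ := GRing.Lalgebra_isAlgebra.Build F Cl cl_scaleAr.

Lemma cl_genM (j k : 'I_m) :
  cl_gen j * cl_gen k + cl_gen k * cl_gen j = (- (2 * (j == k)%:R))%:A.
Proof.
rewrite [_ * cl_gen k]cl_basisM [_ * cl_gen j]cl_basisM (symdC [set k]).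
rewrite -scalerDl /cl_inv !big_set1; case: (eqVneq j k) => [->|jk].
  by rewrite leqnn symdd mulr1 expr1 -opprD.
have := jk; rewrite -val_eqE neq_ltn mulr0 oppr0 scale0r.
by case/orP=> lt; rewrite (ltnW lt) leqNgt lt /= ?expr0 ?expr1 ?subrr ?addNr scale0r.
Qed.

Lemma cl_basis_prod A : cl_basis A = \prod_(j <- enum A) cl_gen j.
Proof.
have: sorted (fun i j : 'I_m => (i < j)%N) (enum A).
  rewrite /enum_mem -enumT; apply: sorted_filter => [i j k|]; first exact: ltn_trans.
  by have := iota_ltn_sorted 0 m; rewrite -val_enum_ord sorted_map.
rewrite -[in LHS](set_enum A); elim: (enum A) => [_|a s IH].
  rewrite big_nil -[1]/(cl_basis set0).
  by congr cl_basis; apply/setP=> j; rewrite !inE.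
move=> as_sorted; have lt_as : all (fun j : 'I_m => (a < j)%N) s.
  by apply: order_path_min as_sorted => i j k; apply: ltn_trans.
rewrite big_cons -IH; last exact: path_sorted as_sorted.
rewrite [RHS]cl_basisM /cl_inv big_set1 big1 => [|b]; last first.
  by rewrite inE => /(allP lt_as) /=; rewrite ltnNge => /negPf->.
rewrite scale1r; congr cl_basis; apply/setP=> j; rewrite in_symd !inE.
case: eqP => // -> /=; case: (boolP (a \in s)) => // /(allP lt_as).
by rewrite ltnn.
Qed.

Lemma cl_expand x : x = \sum_A x A *: cl_basis A.
Proof.
apply/ffunP=> B; rewrite sum_ffunE (bigD1 B) //= big1 => [|A AB].
  by rewrite cl_scaleE ffunE eqxx mulr1 addr0.
by rewrite cl_scaleE ffunE eq_sym (negPf AB) mulr0.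
Qed.

End CliffordAlgebra.

Section HermitianClifford.
Variables (C : numClosedFieldType) (n : nat).
Local Notation V := 'rV[C]_n.
Local Notation Cl := (clifford C (n + n)).
Implicit Types (z u : V) (j k : 'I_n).

(* e_j and e_(n+j) are the generators of index lshift n j and rshift n j.     *)
Definition witt j : Cl :=
  2^-1 *: (cl_gen C (lshift n j) - 'i *: cl_gen C (rshift n j)).

Definition wittd j : Cl :=
  - (2^-1 *: (cl_gen C (lshift n j) + 'i *: cl_gen C (rshift n j))).

Definition hip z u : C := \sum_j z 0 j * (u 0 j)^*.

Definition hvec z : Cl := \sum_j z 0 j *: witt j.

Definition hvecd z : Cl := \sum_j (z 0 j)^* *: wittd j.

Definition cl_beta : Cl := \sum_j wittd j * witt j.

Definition cl_wedge (a b : Cl) : Cl := 2^-1 *: (a * b - b * a).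

(* The Jacobi polynomial P_k^(a,b) for integer parameters a, b >= 0, with     *)
(* Gamma (m + 1) = m`!.                                                       *)
Definition jacobi (k a b : nat) (x : C) : C :=
  (a + k)`!%:R / (k`!%:R * (a + b + k)`!%:R) *
  \sum_(0 <= j < k.+1) 'C(k, j)%:R *
     ((a + b + k + j)`!%:R / (a + j)`!%:R) * ((x - 1) / 2) ^+ j.

Definition kernel_cst (p q : nat) : C :=
  (n - 1 + p + q)%:R / (n - 1)%:R * 'C(n - 2 + p, p)%:R.

(* s is 0 when z = 0 or u = 0, by the convention x / 0 = 0; in hkernel below, *)
(* for p + q > 0, the other factors vanish there, so that hkernel agrees      *)
(* everywhere with the polynomial obtained by clearing denominators.          *)
Definition hip_s z u : C :=
  hip z u * (hip z u)^* / (hip z z * hip u u).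

(* The harmonic kernel K_(p,q), for q <= p. *)
Definition hkernel (p q : nat) z u : C :=
  kernel_cst p q * hip z u ^+ (p - q) * hip z z ^+ q * hip u u ^+ q *
  jacobi q (n - 2) (p - q) (2 * hip_s z u - 1).

Lemma cl_antiD (a b c d : Cl) (s t : C) :
  (a + s *: b) * (c + t *: d) + (c + t *: d) * (a + s *: b) =
  (a * c + c * a) + t *: (a * d + d * a) + s *: (b * c + c * b)
  + (s * t) *: (b * d + d * b).
Proof.
rewrite !mulrDl !mulrDr -!scalerAl -!scalerAr !scalerA !scalerDr [t * s]mulrC.
by rewrite [LHS](AC ((2*2)*(2*2)) ((1*5)*(2*7)*(3*6)*(4*8))).
Qed.

Lemma wittM j k : witt j * witt k + witt k * witt j = 0.
Proof.
rewrite /witt -!scaleNr.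
rewrite -!scalerAl -!scalerAr -!scalerDr cl_antiD !cl_genM.
rewrite !scalerA -!scalerDl !eq_lshift !eq_rshift eq_lrshift eq_rlshift.
rewrite !(mulr0n, mulr0, oppr0, addr0) [- 'i * - 'i]mulrNN -['i * 'i]expr2 sqrCi mulN1r opprK addNr.
by rewrite scale0r scaler0.
Qed.

Lemma wittdM j k : wittd j * wittd k + wittd k * wittd j = 0.
Proof.
rewrite /wittd !mulrNN.
rewrite -!scalerAl -!scalerAr -!scalerDr cl_antiD !cl_genM.
rewrite !scalerA -!scalerDl !eq_lshift !eq_rshift eq_lrshift eq_rlshift.
rewrite !(mulr0n, mulr0, oppr0, addr0) -['i * 'i]expr2 sqrCi mulN1r opprK addNr.
by rewrite scale0r scaler0.
Qed.

Lemma witt_wittdM j k :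
  witt j * wittd k + wittd k * witt j = (j == k)%:R.
Proof.
rewrite /witt /wittd mulrN mulNr -opprD -!scaleNr.
rewrite -!scalerAl -!scalerAr -!scalerDr cl_antiD !cl_genM.
rewrite !scalerA -!scalerDl !eq_lshift !eq_rshift eq_lrshift eq_rlshift.
rewrite !(mulr0n, mulr0, oppr0, addr0) [- 'i * 'i]mulNr -['i * 'i]expr2 sqrCi opprK mul1r.
rewrite scalerA -scaleNr; case: (j == k); last first.
  by rewrite !(mulr0n, mulr0, oppr0, addr0) scale0r.
by rewrite -[RHS]scale1r mulr1n; congr (_ *: _); field.
Qed.

End HermitianClifford.

Section HermitianDirac.
Variables (R : realType) (n : nat).
Local Notation V := 'rV[R[i]]_n.
Local Notation Cl := (clifford R[i] (n + n)).
Implicit Types (z v : V) (g : V -> Cl) (j : 'I_n).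

(* Derivative of g at z along the real direction v of C^n = R^2n, taken on    *)
(* the real and imaginary parts of every coordinate of g.                     *)
Definition rderive v g z : Cl :=
  [ffun A => Complex
     (derive1 (fun t : R => complex.Re (g (z + t%:C%C *: v) A)) 0)
     (derive1 (fun t : R => complex.Im (g (z + t%:C%C *: v) A)) 0)].

(* As z_j = x_j + i x_(n+j), the x_j-axis is spanned by the j-th vector of    *)
(* the canonical basis and the x_(n+j)-axis by i times this vector.           *)
Definition dz j g z : Cl :=
  2^-1 *: (rderive (delta_mx 0 j) g z
           - 'i *: rderive ('i *: delta_mx 0 j) g z).

Definition dzbar j g z : Cl :=
  2^-1 *: (rderive (delta_mx 0 j) g z
           + 'i *: rderive ('i *: delta_mx 0 j) g z).

Definition dirac_l g z : Cl := \sum_j wittd R[i] j * dz j g z.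

Definition diracd_l g z : Cl := \sum_j witt R[i] j * dzbar j g z.

Definition dirac_r g z : Cl := \sum_j dz j g z * wittd R[i] j.

Definition diracd_r g z : Cl := \sum_j dzbar j g z * witt R[i] j.

End HermitianDirac.

(* Main.v *)
Require Import Defs.
From mathcomp Require Import all_boot all_order all_algebra.
From mathcomp Require Import complex reals.
From mathcomp Require Import ring zify normedtype derive.

Set Implicit Arguments.
Unset Strict Implicit.
Unset Printing Implicit Defensive.

Import Order.TTheory GRing.Theory Num.Theory.
Import numFieldNormedType.Exports.

Local Open Scope ring_scope.

(** Write a = <z,u>, b = <u,z>, r = <z,z>, t = <u,u> and w = r t.  The kernel
K is a function of a, b and w alone, so a Dirac operator acts on it through
partial derivatives in these variables, times one of the four vectors z, u, z+,
u+ of the Clifford algebra (z+ and u+ stand for the daggered vectors).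

The key is to replace the Jacobi polynomials by the polynomials
  Z(l; P, Q) = sum_k (l + P + Q - k)! / ((P - k)! (Q - k)! k!)
                     a^(P-k) b^(Q-k) (-w)^k,
which are, up to the factor l!, the coefficients of x^P y^Q in
(1 - a x - b y + w x y)^(-l-1).  Their derivatives carry no constants:
  dZ/da = Z(l+1; P-1, Q),  dZ/db = Z(l+1; P, Q-1),  dZ/dw = - Z(l+1; P-1, Q-1),
and the Euler identities [zonal_eulerl], [zonal_eulerr] together with
[zonal_raise] are the only relations between them that the proof uses.  By
[jacobi_zonal], a^B w^k P_k^(A,B)(2s-1) is a ratio of factorials times
Z(A; B+k, k), so K is a multiple of Z(n-2; p+1, q+1), and each of the four
Jacobi polynomials of the formula is one of
  E = Z(n-1; p, q),  B = Z(n; p-1, q),  C = Z(n; p, q-1),  D = Z(n; p-1, q-1).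

Differentiating on the left gives [left_image], whose words are u u+, z u+, u z+,
z z+ and n - beta.  The first operator on the right turns it into
N = n + p + q + 1 times
  E (beta + p) u - t (n+p-1) Z(n-1; p-1, q) z + B z u u+ - t D z u z+,
which is [middle_image]: after normal ordering, every coefficient of the raw
derivative collapses by the relations above, and the coefficient of beta z
vanishes.  The second operator on the right yields the formula of the theorem
([dirac_r_middle_image]) once its right-hand side is put in the same normal
order.

All functions involved are polynomials in the coordinates and their conjugates,
so the derivatives are computed with a product rule for pairs of Wirtinger
gradients ([wirtinger], [cl_wirtinger]).  Since the identity
K = const Z(n-2; p+1, q+1) also holds when z or u vanishes (both sides are then
0), the computation needs no case distinction. *)

(** * Linear identities in a module *)

(** Formal linear combinations of atoms, so that an identity between two of them
reduces to one scalar identity per atom. *)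
Inductive lin_exp (F : Type) :=
  LAtom of nat | LScale of F & lin_exp F | LAdd of lin_exp F & lin_exp F
| LOpp of lin_exp F | LZero.
Arguments LAtom {F}. Arguments LZero {F}.

Section LinExp.
Variables (F : comNzRingType) (V : lmodType F).

Fixpoint lin_eval (W : seq V) (e : lin_exp F) : V :=
  match e with
  | LAtom i => W`_i
  | LScale c e => c *: lin_eval W e
  | LAdd e1 e2 => lin_eval W e1 + lin_eval W e2
  | LOpp e => - lin_eval W e
  | LZero => 0
  end.

Fixpoint lin_coef (e : lin_exp F) (i : nat) : F :=
  match e with
  | LAtom k => if eqn i k then 1 else 0
  | LScale c e => c * lin_coef e i
  | LAdd e1 e2 => lin_coef e1 i + lin_coef e2 i
  | LOpp e => - lin_coef e i
  | LZero => 0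
  end.

Fixpoint lin_agree n (e1 e2 : lin_exp F) : Prop :=
  if n is n'.+1 then lin_coef e1 n' = lin_coef e2 n' /\ lin_agree n' e1 e2 else True.

Lemma lin_evalE W e :
  lin_eval W e = \sum_(i < size W) lin_coef e i *: W`_i.
Proof.
elim: e => [k|c e IH|e1 IH1 e2 IH2|e IH|] /=.
- have [lt|ge] := ltnP k (size W).
    rewrite (bigD1 (Ordinal lt)) //= [eqn k k]eqxx scale1r big1 ?addr0 // => i ik.
    by rewrite -[eqn _ _]/(nat_of_ord i == k) -[k]/(val (Ordinal lt)) val_eqE (negPf ik) scale0r.
  rewrite nth_default // big1 // => i _.
  by rewrite -[eqn _ _]/(nat_of_ord i == k) ltn_eqF ?scale0r // (leq_trans (ltn_ord i)).
- by rewrite IH scaler_sumr; apply: eq_bigr => i _; rewrite scalerA.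
- by rewrite IH1 IH2 -big_split; apply: eq_bigr => i _; rewrite scalerDl.
- by rewrite IH -sumrN; apply: eq_bigr => i _; rewrite scaleNr.
- by rewrite big1 // => i _; rewrite scale0r.
Qed.

(** Comparing coefficients is sound whether or not the atoms are independent. *)
Lemma lin_agree_eval W e1 e2 :
  lin_agree (size W) e1 e2 -> lin_eval W e1 = lin_eval W e2.
Proof.
rewrite !lin_evalE; suff agree n : lin_agree n e1 e2 ->
    forall i, (i < n)%N -> lin_coef e1 i = lin_coef e2 i.
  by move=> /agree E; apply: eq_bigr => i _; rewrite E.
elim: n => //= n IH [E En] i; rewrite ltnS leq_eqVlt.
by case/predU1P => [->|/(IH En)].
Qed.
End LinExp.

(** Equal words of the Clifford algebra may differ in the structure instances
they are elaborated with, so they are compared up to those. *)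
Ltac same_word x y :=
  lazymatch x with
  | @GRing.one _ => lazymatch y with @GRing.one _ => idtac end
  | GRing.mul ?x1 ?x2 =>
    lazymatch y with GRing.mul ?y1 ?y2 => same_word x1 y1; same_word x2 y2 end
  | @hvec _ _ ?v => lazymatch y with @hvec _ _ ?v' => constr_eq v v' end
  | @hvecd _ _ ?v => lazymatch y with @hvecd _ _ ?v' => constr_eq v v' end
  | @witt _ _ ?j => lazymatch y with @witt _ _ ?j' => constr_eq j j' end
  | @wittd _ _ ?j => lazymatch y with @wittd _ _ ?j' => constr_eq j j' end
  | cl_beta _ _ => lazymatch y with cl_beta _ _ => idtac end
  | _ => constr_eq x y
  end.

Ltac lin_index W x :=
  match W with
  | ?y :: _ => let _ := match goal with _ => same_word x y end in constr:(O)
  | _ :: ?W' => let k := lin_index W' x in constr:(S k)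
  end.

Ltac lin_insert W x :=
  match W with
  | _ => let _ := lin_index W x in W
  | _ => constr:(x :: W)
  end.

Ltac lin_atoms W e :=
  lazymatch e with
  | GRing.add ?x ?y => let W' := lin_atoms W x in lin_atoms W' y
  | GRing.opp ?x => lin_atoms W x
  | GRing.scale ?c ?x => lin_atoms W x
  | @GRing.zero _ => W
  | _ => lin_insert W e
  end.

Ltac lin_reify F W e :=
  lazymatch e with
  | GRing.add ?x ?y =>
      let x' := lin_reify F W x in let y' := lin_reify F W y in
      constr:(@LAdd F x' y')
  | GRing.opp ?x => let x' := lin_reify F W x in constr:(@LOpp F x')
  | GRing.scale ?c ?x => let x' := lin_reify F W x in constr:(@LScale F c x')
  | @GRing.zero _ => constr:(@LZero F)
  | _ => let k := lin_index W e in constr:(@LAtom F k)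
  end.

Ltac lin_split F :=
  lazymatch goal with
  | |- @eq ?T ?l ?r =>
    let W0 := constr:(@nil T) in
    let W1 := lin_atoms W0 l in let W := lin_atoms W1 r in
    let l' := lin_reify F W l in let r' := lin_reify F W r in
    refine (@lin_agree_eval _ _ W l' r' _);
    cbn [lin_agree lin_coef size eqn]; do ?split
  end.

(** * A reflection formula for Jacobi polynomials *)

Section JacobiReflection.
Variable (F : comNzRingType).
Implicit Types (x y : F).

Lemma binom_shift k x y i : (i <= k)%N ->
  x ^+ i * (x + y) ^+ (k - i) =
  \sum_(j < k.+1 | (i <= j)%N) 'C(k - i, j - i)%:R * (x ^+ j * y ^+ (k - j)).
Proof.
move=> le_ik; rewrite (addrC x) exprDn mulr_sumr.
rewrite -(big_mkord xpredT (fun l => x ^+ i * (y ^+ (k - i - l) * x ^+ l *+ 'C(k - i, l)))).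
rewrite -(big_mkord (fun j => i <= j)%N (fun j => 'C(k - i, j - i)%:R * (x ^+ j * y ^+ (k - j)))).
rewrite [RHS](big_cat_nat (n := i)) //=; last by rewrite ltnW.
rewrite [X in X + _]big_nat_cond [X in X + _]big1 ?add0r; last first.
  by move=> j /andP[/andP[_ lt]]; rewrite leqNgt lt.
have -> : \sum_(i <= j < k.+1 | (i <= j)%N) 'C(k - i, j - i)%:R * (x ^+ j * y ^+ (k - j))
  = \sum_(i <= j < k.+1) 'C(k - i, j - i)%:R * (x ^+ j * y ^+ (k - j)).
  rewrite big_nat_cond [RHS]big_nat_cond; apply: eq_bigl => j.
  by case: (i <= j)%N => //=; rewrite andbT.
rewrite [RHS](big_addn 0%N _ i) subSn //.
apply: eq_big_nat => l /andP[_ lt]; rewrite addnK -subnDA -mulr_natl (addnC l) exprD.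
by ring.
Qed.

(** The right-hand side is the form of a Jacobi polynomial that treats its two
singular points alike; expanding the powers of x + y and summing with
Vandermonde's convolution gives the expansion at one of them. *)
Lemma jacobi_vandermonde k A B x y :
  \sum_(j < k.+1) ('C(k + A, k - j) * 'C(k + A + B + j, j))%:R *
     (x ^+ j * y ^+ (k - j)) =
  \sum_(i < k.+1) ('C(k + A, k - i) * 'C(k + B, i))%:R *
     (x ^+ i * (x + y) ^+ (k - i)).
Proof.
under [RHS]eq_bigr => i _ do
  rewrite binom_shift -1?ltnS // mulr_sumr big_mkcond /=.
rewrite exchange_big /=; apply: eq_bigr => j _.
rewrite -big_mkcond /=.
under eq_bigr => i _ do rewrite mulrA -natrM.
rewrite -mulr_suml -natr_sum; congr (_%:R * _).
have le_jk: (j <= k)%N by rewrite -ltnS.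
have -> : (k + A + B + j = k + B + (A + j))%N by lia.
rewrite -(binomial.Vandermonde (k + B) (A + j) j) big_distrr /=.
rewrite -(big_mkord xpredT (fun i => 'C(k + A, k - j) * ('C(k + B, i) * 'C(A + j, j - i)))%N).
rewrite -(big_mkord (fun i => i <= j)%N (fun i => 'C(k + A, k - i) * 'C(k + B, i) * 'C(k - i, j - i))%N).
rewrite [RHS](big_cat_nat (n := j.+1)) //= [X in _ = (_ + X)%N]big_nat_cond.
rewrite [X in _ = (_ + X)%N]big1 ?addn0; last first.
  by move=> i /andP[/andP[lt _]]; rewrite leqNgt lt.
rewrite big_nat_cond [RHS]big_nat_cond; apply: eq_big => [i|i /andP[/andP[_ lt] _]].
  by rewrite ltnS; case: (i <= j)%N.
have Ei : ('C(k + A, k - i) * 'C(k - i, j - i) = 'C(k + A, k - j) * 'C(A + j, j - i))%N.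
  apply/eqP; rewrite -(eqn_pmul2r (fact_gt0 (k - j))) -(eqn_pmul2r (fact_gt0 (j - i))).
  rewrite -(eqn_pmul2r (fact_gt0 (A + i))); apply/eqP.
  transitivity ((k + A)`!).
    have := @bin_fact (k + A) (k - i); have := @bin_fact (k - i) (j - i).
    have -> : (k - i - (j - i) = k - j)%N by lia.
    have -> : (k + A - (k - i) = A + i)%N by lia.
    move=> H1 H2; rewrite -H2; last by lia.
    rewrite -H1; last by lia.
    by ring.
  have := @bin_fact (k + A) (k - j); have := @bin_fact (A + j) (j - i).
  have -> : (A + j - (j - i) = A + i)%N by lia.
  have -> : (k + A - (k - j) = A + j)%N by lia.
  move=> H1 H2; rewrite -H2; last by lia.
  rewrite -H1; last by lia.
  by ring.
by rewrite mulnCA -Ei; ring.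
Qed.

(** Homogeneous form of P_k^(A,B)(-x) = (-1)^k P_k^(B,A)(x): both sides equal
the symmetric sum of [jacobi_vandermonde], one with x - y and y, the other with
x and - y. *)
Lemma jacobi_reflect k A B x y :
  \sum_(j < k.+1) ('C(k + A, k - j) * 'C(k + A + B + j, j))%:R *
     ((x - y) ^+ j * y ^+ (k - j)) =
  \sum_(j < k.+1) ('C(k + B, k - j) * 'C(k + A + B + j, j))%:R *
     (x ^+ j * (- y) ^+ (k - j)).
Proof.
have := jacobi_vandermonde k B A x (- y); rewrite addnAC => ->.
rewrite jacobi_vandermonde subrK (reindex_inj rev_ord_inj) /=.
apply: eq_bigr => i _; have le: (i <= k)%N by rewrite -ltnS.
by rewrite subSS subKn // mulnC (mulrC (_ ^+ _)).
Qed.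
End JacobiReflection.

(** * The zonal polynomials Z(l; P, Q) *)

Section Zonal.
Variable (F : numFieldType).
Implicit Types (a b w x : F) (P Q i : int) (l k N : nat).

(** Divided powers with integer exponents: the value 0 at negative exponents
lets bidegrees become negative under differentiation without side conditions. *)
Definition dpow x i : F := if i is Posz m then x ^+ m / m`!%:R else 0.

Lemma mul_dpow x i : x * dpow x (i - 1) = i%:~R * dpow x i.
Proof.
case: i => [[|m]|m].
- by rewrite sub0r mulr0 mul0r.
- have -> : Posz m.+1 - 1 = m by lia.
  rewrite /= factS natrM exprS -[(Posz m.+1)%:~R]/(m.+1%:R).
  by field; rewrite pnatr_eq0 -lt0n fact_gt0 addrC natr1 pnatr_eq0.
- have -> : Negz m - 1 = Negz m.+1 by lia.
  by rewrite /= !mulr0.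
Qed.

(** When the term is nonzero, k is at most P and at most Q, so the absolute value
is that of a natural number. *)
Definition zonal_term l P Q a b w k : F :=
  (absz (l%:Z + P + Q - k%:Z)%R)`!%:R *
  (dpow a (P - k%:Z) * dpow b (Q - k%:Z) * dpow (- w) k).

Definition zonal l P Q a b w : F :=
  \sum_(0 <= k < `|P|.+1) zonal_term l P Q a b w k.

Lemma dpow_lt0 x i : i < 0 -> dpow x i = 0.
Proof. by case: i. Qed.

Lemma zonal_term_out l P Q a b w k :
  (P < k%:Z) || (Q < k%:Z) -> zonal_term l P Q a b w k = 0.
Proof.
rewrite /zonal_term -(subr_lt0 k%:Z) -(subr_lt0 k%:Z).
by case/orP=> /dpow_lt0->; rewrite ?(mul0r, mulr0).
Qed.

(** Terms with k > P or k > Q vanish, so any large enough upper bound gives the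
same sum; sums of different bidegrees can thus be given a common range. *)
Lemma zonalE N l P Q a b w : (P < N%:Z) || (Q < N%:Z) ->
  zonal l P Q a b w = \sum_(0 <= k < N) zonal_term l P Q a b w k.
Proof.
pose f := zonal_term l P Q a b w.
have extend m M : (m <= M)%N ->
    (forall k, (m <= k)%N -> (P < k%:Z) || (Q < k%:Z)) ->
    \sum_(0 <= k < m) f k = \sum_(0 <= k < M) f k.
  move=> le_mM out; rewrite [RHS](big_cat_nat (n := m)) //= big_nat_cond.
  rewrite [X in _ = _ + X]big_nat_cond [X in _ = _ + X]big1 -?big_nat_cond ?addr0 //.
  by move=> k /andP[/andP[le_mk _] _]; apply: zonal_term_out; apply: out.
move=> ltN; rewrite /zonal (@extend _ (maxn `|P|.+1 N)) ?leq_maxl //; last by lia.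
by rewrite [RHS](@extend _ (maxn `|P|.+1 N)) ?leq_maxr //; lia.
Qed.

(** This is the action of w d/dw, which multiplies the k-th term by k. *)
Lemma mul_w_zonal N l P Q a b w : P < N%:Z ->
  - (w * zonal l.+1 (P - 1) (Q - 1) a b w) =
  \sum_(0 <= k < N) k%:R * zonal_term l P Q a b w k.
Proof.
move=> ltPN; rewrite (@zonalE N); last by rewrite orbC; lia.
rewrite -mulNr mulr_sumr.
transitivity (\sum_(0 <= k < N.+1) k%:R * zonal_term l P Q a b w k); last first.
  by rewrite big_nat_recr //= zonal_term_out ?ltPN // mulr0 addr0.
rewrite big_nat_recl // mul0r add0r; apply: eq_bigr => k _.
rewrite /zonal_term.
have -> : l.+1%:Z + (P - 1) + (Q - 1) - k%:Z = l%:Z + P + Q - k.+1%:Z by lia.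
have -> : P - 1 - k%:Z = P - k.+1%:Z by lia.
have -> : Q - 1 - k%:Z = Q - k.+1%:Z by lia.
have := mul_dpow (- w) k.+1%:Z; have -> : k.+1%:Z - 1 = k by lia.
rewrite -[_%:~R]/(k.+1%:R) => E.
rewrite [LHS]mulrCA -[RHS]mulrCA; congr (_ * _).
by rewrite mulrCA E; ring.
Qed.

(** Homogeneity: a d/da + w d/dw multiplies the k-th term by (P - k) + k. *)
Lemma zonal_eulerl l P Q a b w :
  P%:~R * zonal l P Q a b w =
  a * zonal l.+1 (P - 1) Q a b w - w * zonal l.+1 (P - 1) (Q - 1) a b w.
Proof.
pose N := `|P|.+1; have ltPN : P < N%:Z by lia.
rewrite (mul_w_zonal l Q a b w ltPN) !(@zonalE N) ?ltPN //; last by lia.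
rewrite !mulr_sumr -big_split /=; apply: eq_bigr => k _; rewrite /zonal_term.
have -> : l.+1%:Z + (P - 1) + Q - k%:Z = l%:Z + P + Q - k%:Z by lia.
have -> : P - 1 - k%:Z = P - k%:Z - 1 by lia.
have := mul_dpow a (P - k%:Z); rewrite rmorphB /= -[(k%:Z)%:~R]/(k%:R) => E.
by ring: E.
Qed.

(** Homogeneity in b and w, as for [zonal_eulerl]. *)
Lemma zonal_eulerr l P Q a b w :
  Q%:~R * zonal l P Q a b w =
  b * zonal l.+1 P (Q - 1) a b w - w * zonal l.+1 (P - 1) (Q - 1) a b w.
Proof.
pose N := `|P|.+1; have ltPN : P < N%:Z by lia.
rewrite (mul_w_zonal l Q a b w ltPN) !(@zonalE N) ?ltPN //.
rewrite !mulr_sumr -big_split /=; apply: eq_bigr => k _; rewrite /zonal_term.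
have -> : l.+1%:Z + P + (Q - 1) - k%:Z = l%:Z + P + Q - k%:Z by lia.
have -> : Q - 1 - k%:Z = Q - k%:Z - 1 by lia.
have := mul_dpow b (Q - k%:Z); rewrite rmorphB /= -[(k%:Z)%:~R]/(k%:R) => E.
by ring: E.
Qed.

(** Raising l multiplies the k-th term by l + 1 + P + Q - k; the part - k is
again w d/dw. *)
Lemma zonal_raise l P Q a b w :
  zonal l.+1 P Q a b w =
  (l.+1%:Z + P + Q)%:~R * zonal l P Q a b w
  + w * zonal l.+1 (P - 1) (Q - 1) a b w.
Proof.
pose N := `|P|.+1; have ltPN : P < N%:Z by lia.
apply/eqP; rewrite -subr_eq (mul_w_zonal l Q a b w ltPN) !(@zonalE N) ?ltPN //.
rewrite mulr_sumr -big_split /=; apply/eqP/eq_bigr => k _.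
case: (boolP ((P < k%:Z) || (Q < k%:Z))) => [out|].
  by rewrite !zonal_term_out // !mulr0 addr0.
rewrite negb_or -!leNgt => /andP[leP leQ]; rewrite /zonal_term.
have [m Em] : exists m, l%:Z + P + Q - k%:Z = m%:Z.
  by exists (absz (l%:Z + P + Q - k%:Z)%R); lia.
have -> : l.+1%:Z + P + Q - k%:Z = m.+1 by lia.
have -> : l.+1%:Z + P + Q = m%:Z + k%:Z + 1 by lia.
rewrite Em !absz_nat factS natrM !rmorphD /=.
rewrite -[(k%:Z)%:~R]/(k%:R) -[(m%:Z)%:~R]/(m%:R) -natr1.
by ring.
Qed.

Lemma zonal_origin l P Q b : P != 0 -> zonal l P Q 0 b 0 = 0.
Proof.
move=> P0; have := zonal_eulerl l P Q 0 b 0; rewrite !mul0r subr0.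
by move/eqP; rewrite mulf_eq0 intr_eq0 (negPf P0) => /eqP.
Qed.

End Zonal.

(** The zonal values are generalized first, to keep [ring] from unfolding the sums
when it compares two of them. *)
Ltac zonal_ring :=
  repeat match goal with
  | |- context [zonal ?k ?i ?j ?x ?y ?v] => generalize (zonal k i j x y v); intro
  end; ring.

Section MiddleCoefficients.
Variables (F : numFieldType) (l : nat) (P Q : int) (a b w : F).
Local Notation Z k i j := (zonal k i j a b w).
Local Notation N := ((l.+2%:Z + P + Q)%:~R : F).

(** This and the next four lemmas evaluate the coefficients of beta u, u, z,
z u u+ and z u z+ after the first differentiation on the right, without the
factor t common to z and z u z+; here l = n - 1.  Together they show that the factor N = n + P + Q + 1 splits off. *)
Lemma middle_beta_u :
  Z l.+1 P Q + Z l P Q - w * Z l.+1 (P - 1) (Q - 1) = N * Z l P Q.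
Proof. by rewrite (zonal_raise l P); zonal_ring. Qed.

Lemma middle_u :
  a * Z l.+2 (P - 1) Q - 2 * w * Z l.+2 (P - 1) (Q - 1)
  - b * Z l.+1 P (Q - 1) + w * (b * Z l.+2 (P - 1) (Q - 1 - 1))
  - l.+1%:R * (Z l P Q - w * Z l.+1 (P - 1) (Q - 1)) + Z l.+1 P Q =
  N * (P%:~R * Z l P Q).
Proof.
have := zonal_eulerl l.+1 P Q a b w; have := zonal_eulerr l P Q a b w.
have := zonal_eulerr l.+1 (P - 1) (Q - 1) a b w.
rewrite (zonal_raise l.+1 (P - 1) (Q - 1)) (zonal_raise l P Q).
move=> euD euE euA.
have -> : b * Z l.+2 (P - 1) (Q - 1 - 1) =
    (Q - 1)%:~R * Z l.+1 (P - 1) (Q - 1) + w * Z l.+2 (P - 1 - 1) (Q - 1 - 1).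
  by rewrite euD subrK.
have -> : b * Z l.+1 P (Q - 1) = Q%:~R * Z l P Q + w * Z l.+1 (P - 1) (Q - 1).
  by rewrite euE subrK.
have -> : a * Z l.+2 (P - 1) Q = 
    P%:~R * ((l.+1%:Z + P + Q)%:~R * Z l P Q + w * Z l.+1 (P - 1) (Q - 1))
    + w * ((l.+2%:Z + (P - 1) + (Q - 1))%:~R * Z l.+1 (P - 1) (Q - 1)
           + w * Z l.+2 (P - 1 - 1) (Q - 1 - 1)).
  by rewrite euA subrK.
by zonal_ring.
Qed.

Lemma middle_z :
  2 * w * Z l.+2 (P - 1 - 1) (Q - 1) - a * Z l.+2 (P - 1 - 1) Q
  - l.+3%:R * Z l.+1 (P - 1) Q + 2 * (b * Z l.+1 (P - 1) (Q - 1))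
  - w * (b * Z l.+2 (P - 1 - 1) (Q - 1 - 1)) =
  - (N * ((l%:Z + P)%:~R * Z l (P - 1) Q)).
Proof.
have := zonal_eulerl l.+1 (P - 1) Q a b w; have := zonal_eulerr l (P - 1) Q a b w.
have := zonal_eulerr l.+1 (P - 1 - 1) (Q - 1) a b w.
rewrite (zonal_raise l.+1 (P - 1 - 1) (Q - 1)) (zonal_raise l (P - 1) Q).
move=> euG' euG euB.
have -> : b * Z l.+2 (P - 1 - 1) (Q - 1 - 1) =
    (Q - 1)%:~R * Z l.+1 (P - 1 - 1) (Q - 1) + w * Z l.+2 (P - 1 - 1 - 1) (Q - 1 - 1).
  by rewrite euG' subrK.
have -> : b * Z l.+1 (P - 1) (Q - 1) =
    Q%:~R * Z l (P - 1) Q + w * Z l.+1 (P - 1 - 1) (Q - 1).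
  by rewrite euG subrK.
move/eqP: euB; rewrite eq_sym subr_eq => /eqP ->.
by zonal_ring.
Qed.

Lemma middle_zuud :
  Z l.+2 (P - 1) Q + (Z l.+1 (P - 1) Q - w * Z l.+2 (P - 1 - 1) (Q - 1)) =
  N * Z l.+1 (P - 1) Q.
Proof. by rewrite (zonal_raise l.+1 (P - 1) Q); zonal_ring. Qed.

Lemma middle_zuzd :
  Z l.+2 (P - 1) (Q - 1)
  + (2 * Z l.+1 (P - 1) (Q - 1) - w * Z l.+2 (P - 1 - 1) (Q - 1 - 1)) =
  N * Z l.+1 (P - 1) (Q - 1).
Proof. by rewrite (zonal_raise l.+1 (P - 1) (Q - 1)); zonal_ring. Qed.

(** This matches the coefficients of z u u+ z+ after the last differentiation. *)
Lemma final_zuudzd :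
  Z l.+2 (P - 1) (Q - 1)
  + (Z l.+1 (P - 1) (Q - 1) - w * Z l.+2 (P - 1 - 1) (Q - 1 - 1)) =
  (l.+1%:Z + P + Q)%:~R * Z l.+1 (P - 1) (Q - 1).
Proof. by rewrite (zonal_raise l.+1 (P - 1) (Q - 1)); zonal_ring. Qed.

(** This matches the coefficients of z u+ after the last differentiation, where
the word z z+ u u+ of the formula contributes b z u+ on reordering. *)
Lemma final_zud :
  (l%:Z + P)%:~R * (Z l (P - 1) Q - w * Z l.+1 (P - 1 - 1) (Q - 1)) =
  (Q%:~R + 1) * Z l.+1 (P - 1) Q
  - (l.+1%:Z + P + Q)%:~R * (b * Z l.+1 (P - 1) (Q - 1)).
Proof.
have := zonal_eulerr l (P - 1) Q a b w; rewrite (zonal_raise l (P - 1) Q) => euG.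
have -> : b * Z l.+1 (P - 1) (Q - 1) =
    Q%:~R * Z l (P - 1) Q + w * Z l.+1 (P - 1 - 1) (Q - 1).
  by rewrite euG subrK.
by zonal_ring.
Qed.
End MiddleCoefficients.

(** * Jacobi polynomials as zonal polynomials *)

Lemma jacobi_binomial (C : numClosedFieldType) k A B (s : C) :
  jacobi k A B (2 * s - 1) =
  \sum_(j < k.+1) ('C(k + A, k - j) * 'C(k + A + B + j, j))%:R * (s - 1) ^+ j.
Proof.
rewrite /jacobi mulr_sumr big_mkord; apply: eq_bigr => j _.
have -> : (2 * s - 1 - 1) / 2 = s - 1 by field.
rewrite mulrA; congr (_ * _).
have le_jk : (j <= k)%N by rewrite -ltnS.
have f0 m : m`!%:R != 0 :> C by rewrite pnatr_eq0 -lt0n fact_gt0.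
have E1 := bin_fact le_jk.
have := @bin_fact (k + A) (k - j).
have -> : (k + A - (k - j) = A + j)%N by lia.
move=> /(_ ltac:(lia)) E2.
have := @bin_fact (k + A + B + j) j; rewrite addnK leq_addl => /(_ isT) E3.
have -> : (A + B + k + j = k + A + B + j)%N by lia.
have -> : (A + B + k = k + A + B)%N by lia.
rewrite -E3 (addnC A k) -E2 -E1 !natrM; field.
by rewrite !f0 pnatr_eq0 -lt0n bin_gt0 le_jk.
Qed.

(** At w = 0 the hypotheses force a = 0, and both sides vanish because of the
total degree; otherwise the expansion of the Jacobi polynomial at s = 1 is moved
to s = 0 by [jacobi_reflect] and read term by term. *)
Lemma jacobi_zonal (C : numClosedFieldType) k A B (a b w : C) :
  (w = 0 -> a = 0) -> (0 < B + k)%N ->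
  a ^+ B * w ^+ k * jacobi k A B (2 * (a * b / w) - 1) =
  (B + k)`!%:R / (A + B + k)`!%:R * zonal A (B + k)%N k a b w.
Proof.
have f0 m : m`!%:R != 0 :> C by rewrite pnatr_eq0 -lt0n fact_gt0.
have [-> /(_ erefl)-> Bk0|w0 _ _] := eqVneq w 0.
  rewrite zonal_origin ?mulr0; last by case: (B + k)%N Bk0.
  by rewrite !expr0n -natrM mulnb -addn_eq0 gtn_eqF // !mul0r.
rewrite jacobi_binomial -mulrA mulr_sumr.
have E : \sum_(i < k.+1) w ^+ k * (('C(k + A, k - i) * 'C(k + A + B + i, i))%:R *
     (a * b / w - 1) ^+ i) =
  \sum_(j < k.+1) ('C(k + B, k - j) * 'C(k + A + B + j, j))%:R *
     ((a * b) ^+ j * (- w) ^+ (k - j)).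
  rewrite -jacobi_reflect; apply: eq_bigr => i _.
  have le_ik : (i <= k)%N by rewrite -ltnS.
  rewrite mulrCA; congr (_ * _); rewrite -{1}(subnK le_ik) exprD -(mulrA (w ^+ _)).
  by rewrite -exprMn mulrC; congr (_ ^+ _ * _); field.
rewrite E (@zonalE _ k.+1); last by apply/orP; right; lia.
rewrite big_mkord (reindex_inj rev_ord_inj) /= !mulr_sumr.
apply: eq_bigr => i _; have le_ik : (i <= k)%N by rewrite -ltnS.
rewrite subSS subKn // /zonal_term; move: {i}(i : nat) le_ik => i le_ik.
have -> : A%:Z + (B + k)%N%:Z + k%:Z - i%:Z = (A + B + k + (k - i))%N%:Z by lia.
have -> : (B + k)%N%:Z - i%:Z = (B + (k - i))%N%:Z by lia.
have -> : k%:Z - i%:Z = (k - i)%N%:Z by lia.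
rewrite absz_nat /dpow.
have := @bin_fact (k + B) i; have -> : (k + B - i = B + (k - i))%N by lia.
move=> /(_ ltac:(lia)) E2.
have := @bin_fact (k + A + B + (k - i)) (k - i); rewrite addnK leq_addl => /(_ isT) E3.
have -> : (A + B + k = k + A + B)%N by lia.
rewrite -E3 (addnC B k) -E2 !natrM exprMn (exprD a); field.
by rewrite !f0.
Qed.

(** * Wirtinger calculus *)

Section Wirtinger.
Variables (R : realType) (n : nat).
Local Notation C := R[i].
Local Notation V := 'rV[C]_n.
Local Notation Cl := (clifford C (n + n)).
Implicit Types (h : R -> C) (z v : V) (f g : V -> C) (D Db : 'I_n -> C).

(** Derivative at 0 of a complex-valued function of a real variable, through its
real and imaginary parts. *)
Definition cderiv h (l : C) : Prop :=
  is_derive (0 : R) (1 : R) (fun t => complex.Re (h t)) (complex.Re l) /\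
  is_derive (0 : R) (1 : R) (fun t => complex.Im (h t)) (complex.Im l).

Lemma cderiv_cst (c : C) : cderiv (fun=> c) 0.
Proof. by split; apply: is_derive_cst. Qed.

Lemma cderivD h1 h2 l1 l2 :
  cderiv h1 l1 -> cderiv h2 l2 -> cderiv (fun t => h1 t + h2 t) (l1 + l2).
Proof.
move=> [re1 im1] [re2 im2]; split.
  rewrite raddfD; under [fun t => _]boolp.funext => t do rewrite raddfD.
  exact: is_deriveD.
rewrite raddfD; under [fun t => _]boolp.funext => t do rewrite raddfD.
exact: is_deriveD.
Qed.

Lemma complex_ReD (x y : C) : complex.Re (x + y) = complex.Re x + complex.Re y.
Proof. exact: raddfD. Qed.

Lemma complex_ImD (x y : C) : complex.Im (x + y) = complex.Im x + complex.Im y.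
Proof. exact: raddfD. Qed.

Lemma complex_ReM (x y : C) : complex.Re (x * y) =
  complex.Re x * complex.Re y - complex.Im x * complex.Im y.
Proof. by case: x y => [? ?] [? ?]. Qed.

Lemma complex_ImM (x y : C) : complex.Im (x * y) =
  complex.Re x * complex.Im y + complex.Im x * complex.Re y.
Proof. by case: x y => [? ?] [? ?]. Qed.

Lemma cderivM h1 h2 l1 l2 :
  cderiv h1 l1 -> cderiv h2 l2 ->
  cderiv (fun t => h1 t * h2 t) (l1 * h2 0 + h1 0 * l2).
Proof.
move=> [re1 im1] [re2 im2]; split.
  under [fun t => _]boolp.funext => t do rewrite complex_ReM.
  apply: is_derive_eq (is_deriveB (is_deriveM re1 re2) (is_deriveM im1 im2)) _.
  by rewrite complex_ReD !complex_ReM /GRing.scale /=; ring.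
under [fun t => _]boolp.funext => t do rewrite complex_ImM.
apply: is_derive_eq (is_deriveD (is_deriveM re1 im2) (is_deriveM im1 re2)) _.
by rewrite complex_ImD !complex_ImM /GRing.scale /=; ring.
Qed.

(** D and Db are the Wirtinger gradients with respect to z_j and to its conjugate:
the derivative along v is sum_j v_j D_j + conj(v_j) Db_j. *)
Definition wirtinger f z D Db : Prop := forall v,
  cderiv (fun t => f (z + t%:C%C *: v))
         (\sum_j (v 0 j * D j + (v 0 j)^* * Db j)).

Lemma wirtinger_eq f z D Db D' Db' : D =1 D' -> Db =1 Db' ->
  wirtinger f z D Db -> wirtinger f z D' Db'.
Proof.
move=> eD eDb w v; have := w v.
by under eq_bigr => j _ do rewrite eD eDb.
Qed.

Lemma wirtinger_cst c z : wirtinger (fun=> c) z (fun=> 0) (fun=> 0).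
Proof.
move=> v; rewrite big1 => [|j _]; first exact: cderiv_cst.
by rewrite !mulr0 addr0.
Qed.

Lemma wirtingerD f g z D Db D' Db' :
  wirtinger f z D Db -> wirtinger g z D' Db' ->
  wirtinger (fun z => f z + g z) z (fun j => D j + D' j) (fun j => Db j + Db' j).
Proof.
move=> wf wg v; have := cderivD (wf v) (wg v).
rewrite -big_split /=; congr cderiv; apply: eq_bigr => j _; ring.
Qed.

Lemma wirtingerM f g z D Db D' Db' :
  wirtinger f z D Db -> wirtinger g z D' Db' ->
  wirtinger (fun z => f z * g z) z
    (fun j => D j * g z + f z * D' j) (fun j => Db j * g z + f z * Db' j).
Proof.
move=> wf wg v; have := cderivM (wf v) (wg v).
rewrite scale0r addr0 mulr_suml mulr_sumr -big_split /=.
by congr cderiv; apply: eq_bigr => j _; ring.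
Qed.

Lemma wirtinger_sum (I : Type) (s : seq I) (P : pred I) (f : I -> V -> C) z
    (D Db : I -> 'I_n -> C) :
  (forall i, P i -> wirtinger (f i) z (D i) (Db i)) ->
  wirtinger (fun z => \sum_(i <- s | P i) f i z) z
    (fun j => \sum_(i <- s | P i) D i j) (fun j => \sum_(i <- s | P i) Db i j).
Proof.
move=> w; elim: s => [|i s IH].
  rewrite (_ : (fun _ => _) = fun=> 0); last by apply/boolp.funext=> y; rewrite big_nil.
  by apply: wirtinger_eq (wirtinger_cst _ _) => j; rewrite big_nil.
rewrite (_ : (fun _ => _) = fun z => if P i then f i z + \sum_(i <- s | P i) f i z
   else \sum_(i <- s | P i) f i z); last first.
  by apply/boolp.funext=> y; rewrite big_cons.
case: (boolP (P i)) => Pi.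
  by apply: wirtinger_eq (wirtingerD (w i Pi) IH) => j; rewrite big_cons Pi.
by apply: wirtinger_eq IH => j; rewrite big_cons (negPf Pi).
Qed.

Lemma cderiv_line (x y : C) : cderiv (fun t => x + t%:C%C * y) y.
Proof.
have E (a b : R) : is_derive (0 : R) (1 : R) (fun t => a + t * b) b.
  apply: is_derive_eq (is_deriveD (is_derive_cst a (0 : R) 1)
    (is_deriveM (is_derive_id (0 : R) 1) (is_derive_cst b (0 : R) 1))) _.
  by rewrite /GRing.scale /= /functions.cst; ring.
case: x y => [a b] [c d]; split => /=.
  rewrite (_ : (fun t => _) = fun t => a + t * c) //.
  by apply/boolp.funext => t; ring.
rewrite (_ : (fun t => _) = fun t => b + t * d) //.
by apply/boolp.funext => t; ring.
Qed.

Lemma wirtinger_coord i z :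
  wirtinger (fun z => z 0 i) z (fun j => (j == i)%:R) (fun=> 0).
Proof.
move=> v; rewrite (bigD1 i) //= big1 => [|j /negPf ji]; last first.
  by rewrite ji !mulr0 addr0.
rewrite eqxx mulr1 mulr0 !addr0.
under [fun t => _]boolp.funext => t do rewrite !mxE.
exact: cderiv_line.
Qed.

Lemma wirtinger_coordJ i z :
  wirtinger (fun z => (z 0 i)^*) z (fun=> 0) (fun j => (j == i)%:R).
Proof.
move=> v; rewrite (bigD1 i) //= big1 => [|j /negPf ji]; last first.
  by rewrite ji !mulr0 addr0.
rewrite eqxx mulr1 mulr0 add0r addr0.
under [fun t => _]boolp.funext => t do rewrite !mxE rmorphD rmorphM /=.
have E (t : R) : (t%:C%C : C)^* = t%:C%C by exact: conjc_real.
under [fun t => _]boolp.funext => t do rewrite E.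
exact: cderiv_line.
Qed.

Lemma wirtinger_dpow f z D Db (i : int) : wirtinger f z D Db ->
  wirtinger (fun z => dpow (f z) i) z
    (fun j => dpow (f z) (i - 1) * D j) (fun j => dpow (f z) (i - 1) * Db j).
Proof.
move=> wf; case: i => [m|m]; last first.
  have -> : Negz m - 1 = Negz m.+1 by lia.
  by apply: wirtinger_eq (wirtinger_cst 0 z) => j; rewrite mul0r.
elim: m => [|m IH].
  by apply: wirtinger_eq (wirtinger_cst _ z) => j; rewrite sub0r mul0r.
have m0 : m.+1%:R != 0 :> C by rewrite pnatr_eq0.
have E (x : C) : dpow x m.+1 = m.+1%:R^-1 * (x * dpow x m).
  have := mul_dpow x m.+1; have -> : m.+1%:Z - 1 = m by lia. move=> ->. 
  by rewrite -[_%:~R]/(m.+1%:R) mulKf.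
under [fun z => _]boolp.funext => y do rewrite E.
have E' := mul_dpow (f z) m; rewrite -[_%:~R]/(m%:R) in E'.
apply: wirtinger_eq (wirtingerM (wirtinger_cst m.+1%:R^-1 z) (wirtingerM wf IH)) => j;
  have -> : m.+1%:Z - 1 = m by lia.
  by rewrite mul0r add0r (mulrA (f z)) E' -natr1; field; rewrite natr1.
by rewrite mul0r add0r (mulrA (f z)) E' -natr1; field; rewrite natr1.
Qed.

(** The chain rule for Z.  The derivative of the k-th term in w is, up to sign,
the term of index k - 1 of Z(l+1; P-1, Q-1), whence the shift of the sum. *)
Lemma wirtinger_zonal fa fb fw z Da Dba Db Dbb Dw Dbw l P Q :
  wirtinger fa z Da Dba -> wirtinger fb z Db Dbb -> wirtinger fw z Dw Dbw ->
  let Z l P Q := zonal l P Q (fa z) (fb z) (fw z) in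
  let chain Da Db Dw (j : 'I_n) :=
    Z l.+1 (P - 1) Q * Da j + Z l.+1 P (Q - 1) * Db j
    - Z l.+1 (P - 1) (Q - 1) * Dw j in
  wirtinger (fun z => zonal l P Q (fa z) (fb z) (fw z)) z
    (chain Da Db Dw) (chain Dba Dbb Dbw).
Proof.
move=> wa wb ww Z chain; pose N := `|P|%N.
pose fact k := (absz (l%:Z + P + Q - k%:Z)%R)`!%:R : C.
pose da k := dpow (fa z) (P - k%:Z).
pose db k := dpow (fb z) (Q - k%:Z).
pose dw k := dpow (- fw z) k%:Z.
have wN : wirtinger (fun z => - fw z) z (fun j => - Dw j) (fun j => - Dbw j).
  under [fun z => _]boolp.funext => y do rewrite -mulN1r.
  by apply: wirtinger_eq (wirtingerM (wirtinger_cst (-1) z) ww) => j;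
    rewrite mul0r add0r mulN1r.
have chainE D1 D2 D3 : chain D1 D2 D3 =1 fun j => \sum_(0 <= k < N.+1)
   (0 * (da k * db k * dw k) + fact k * (
   (dpow (fa z) (P - k%:Z - 1) * D1 j * db k
     + da k * (dpow (fb z) (Q - k%:Z - 1) * D2 j)) * dw k
   + da k * db k * (dpow (- fw z) (k%:Z - 1) * - D3 j))).
  move=> j; rewrite /chain /Z (@zonalE _ N.+1 l.+1 (P - 1) Q); last by lia.
  rewrite (@zonalE _ N.+1 l.+1 P (Q - 1)); last by lia.
  rewrite (@zonalE _ N l.+1 (P - 1) (Q - 1)); last by lia.
  pose rest k := fact k * (da k * db k * (dpow (- fw z) (k%:Z - 1) * - D3 j)).
  have -> : - ((\sum_(0 <= k < N)
      zonal_term l.+1 (P - 1) (Q - 1) (fa z) (fb z) (fw z) k) * D3 j)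
    = \sum_(0 <= k < N.+1) rest k.
    rewrite big_nat_recl // {1}/rest dpow_lt0 ?mul0r ?mulr0 ?add0r //.
    rewrite -mulrN mulr_suml; apply: eq_bigr => k _.
    rewrite /rest /zonal_term /fact /da /db.
    have -> : l.+1%:Z + (P - 1) + (Q - 1) - k%:Z = l%:Z + P + Q - k.+1%:Z by lia.
    have -> : P - 1 - k%:Z = P - k.+1%:Z by lia.
    have -> : Q - 1 - k%:Z = Q - k.+1%:Z by lia.
    have -> : k.+1%:Z - 1 = k by lia.
    by ring.
  rewrite !mulr_suml -!big_split /=; apply: eq_bigr => k _.
  rewrite /rest /zonal_term -/(fact k) /da /db /dw.
  have -> : l.+1%:Z + (P - 1) + Q - k%:Z = l%:Z + P + Q - k%:Z by lia.
  have -> : l.+1%:Z + P + (Q - 1) - k%:Z = l%:Z + P + Q - k%:Z by lia.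
  have -> : P - 1 - k%:Z = P - k%:Z - 1 by lia.
  have -> : Q - 1 - k%:Z = Q - k%:Z - 1 by lia.
  by rewrite -/(fact k); ring.
apply: wirtinger_eq (fun j => esym (chainE _ _ _ j)) (fun j => esym (chainE _ _ _ j)) _.
apply: wirtinger_sum => k _.
apply: wirtingerM (wirtinger_cst (fact k) z) (wirtingerM (wirtingerM
  (wirtinger_dpow (P - k%:Z) wa) (wirtinger_dpow (Q - k%:Z) wb))
  (wirtinger_dpow k%:Z wN)).
Qed.

Lemma sum_delta (x : 'I_n -> C) j : \sum_i (j == i)%:R * x i = x j.
Proof.
rewrite (bigD1 j) //= eqxx mul1r big1 ?addr0 // => i /negPf ij.
by rewrite eq_sym ij mul0r.
Qed.

Lemma wirtinger_hipl u z :
  wirtinger (fun z => hip z u) z (fun j => (u 0 j)^*) (fun=> 0).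
Proof.
rewrite /hip; apply: wirtinger_eq (wirtinger_sum _ (fun i _ =>
  wirtingerM (wirtinger_coord i z) (wirtinger_cst (u 0 i)^* z))) => j /=.
  by under eq_bigr do rewrite mulr0 addr0; rewrite sum_delta.
by rewrite big1 // => i _; rewrite mulr0 mul0r addr0.
Qed.

Lemma wirtinger_hipr u z :
  wirtinger (fun z => hip u z) z (fun=> 0) (fun j => u 0 j).
Proof.
rewrite /hip; apply: wirtinger_eq (wirtinger_sum _ (fun i _ =>
  wirtingerM (wirtinger_cst (u 0 i) z) (wirtinger_coordJ i z))) => j /=.
  by rewrite big1 // => i _; rewrite mulr0 mul0r addr0.
by under eq_bigr do rewrite mul0r add0r mulrC; rewrite sum_delta.
Qed.

Lemma wirtinger_hip_sq z :
  wirtinger (fun z => hip z z) z (fun j => (z 0 j)^*) (fun j => z 0 j).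
Proof.
rewrite /hip; apply: wirtinger_eq (wirtinger_sum _ (fun i _ =>
  wirtingerM (wirtinger_coord i z) (wirtinger_coordJ i z))) => j /=.
  by under eq_bigr do rewrite mulr0 addr0; rewrite sum_delta.
by under eq_bigr do rewrite mul0r add0r mulrC; rewrite sum_delta.
Qed.

End Wirtinger.

Lemma cl_oppE (F : comNzRingType) m (x : clifford F m) A : (- x) A = - x A.
Proof. by rewrite ffunE. Qed.

Section CWirtinger.
Variables (R : realType) (n : nat).
Local Notation C := R[i].
Local Notation V := 'rV[C]_n.
Local Notation Cl := (clifford C (n + n)).
Implicit Types (z v : V) (f : V -> C) (g : V -> Cl) (D Db : 'I_n -> Cl).

Definition cl_wirtinger g z D Db : Prop := forall A,
  wirtinger (fun z => g z A) z (fun j => D j A) (fun j => Db j A).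

Lemma cl_wirtinger_eq g z D Db D' Db' : D =1 D' -> Db =1 Db' ->
  cl_wirtinger g z D Db -> cl_wirtinger g z D' Db'.
Proof. by move=> eD eDb w A; apply: wirtinger_eq (w A) => j; rewrite ?eD ?eDb. Qed.

Lemma cl_wirtinger_cst (X : Cl) z : cl_wirtinger (fun=> X) z (fun=> 0) (fun=> 0).
Proof. by move=> A; apply: wirtinger_eq (wirtinger_cst _ z) => j; rewrite ffunE. Qed.

Lemma cl_wirtingerD g1 g2 z D1 Db1 D2 Db2 :
  cl_wirtinger g1 z D1 Db1 -> cl_wirtinger g2 z D2 Db2 ->
  cl_wirtinger (fun z => g1 z + g2 z) z
    (fun j => D1 j + D2 j) (fun j => Db1 j + Db2 j).
Proof.
move=> w1 w2 A; under [fun z => _]boolp.funext => y do rewrite cl_addE.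
by apply: wirtinger_eq (wirtingerD (w1 A) (w2 A)) => j; rewrite cl_addE.
Qed.

Lemma cl_wirtingerZ f g z (Df Dbf : 'I_n -> C) D Db :
  wirtinger f z Df Dbf -> cl_wirtinger g z D Db ->
  cl_wirtinger (fun z => f z *: g z) z
    (fun j => Df j *: g z + f z *: D j) (fun j => Dbf j *: g z + f z *: Db j).
Proof.
move=> wf wg A; under [fun z => _]boolp.funext => y do rewrite cl_scaleE.
by apply: wirtinger_eq (wirtingerM wf (wg A)) => j; rewrite cl_addE !cl_scaleE.
Qed.

Lemma cl_wirtingerN g z D Db : cl_wirtinger g z D Db ->
  cl_wirtinger (fun z => - g z) z (fun j => - D j) (fun j => - Db j).
Proof.
move=> w; under [fun z => _]boolp.funext => y do rewrite -scaleN1r.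
by apply: cl_wirtinger_eq (cl_wirtingerZ (wirtinger_cst (-1) z) w) => j;
  rewrite scale0r add0r scaleN1r.
Qed.

Lemma cl_wirtingerB g1 g2 z D1 Db1 D2 Db2 :
  cl_wirtinger g1 z D1 Db1 -> cl_wirtinger g2 z D2 Db2 ->
  cl_wirtinger (fun z => g1 z - g2 z) z
    (fun j => D1 j - D2 j) (fun j => Db1 j - Db2 j).
Proof. by move=> w1 w2; apply: cl_wirtingerD w1 (cl_wirtingerN w2). Qed.

Lemma cl_wirtingerM g1 g2 z D1 Db1 D2 Db2 :
  cl_wirtinger g1 z D1 Db1 -> cl_wirtinger g2 z D2 Db2 ->
  cl_wirtinger (fun z => g1 z * g2 z) z
    (fun j => D1 j * g2 z + g1 z * D2 j) (fun j => Db1 j * g2 z + g1 z * Db2 j).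
Proof.
move=> w1 w2 A.
under [fun z => _]boolp.funext => y do rewrite [_ * _]/(cl_mul _ _) cl_mulE.
apply: wirtinger_eq (wirtinger_sum _ (fun B _ => wirtingerM
  (wirtinger_cst ((-1) ^+ cl_inv B (symd B A)) z)
  (wirtingerM (w1 B) (w2 (symd B A))))) => j;
  rewrite cl_addE ![_ * _]/(cl_mul _ _) !cl_mulE -big_split /=;
  apply: eq_bigr => B _; ring.
Qed.

Lemma cl_wirtinger_sum (I : Type) (s : seq I) (g : I -> V -> Cl) z
    (D Db : I -> 'I_n -> Cl) :
  (forall i, cl_wirtinger (g i) z (D i) (Db i)) ->
  cl_wirtinger (fun z => \sum_(i <- s) g i z) z
    (fun j => \sum_(i <- s) D i j) (fun j => \sum_(i <- s) Db i j).
Proof.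
move=> w A; under [fun z => _]boolp.funext => y do rewrite sum_ffunE.
by apply: wirtinger_eq (wirtinger_sum s (fun i _ => w i A)) => j;
  rewrite sum_ffunE.
Qed.

Lemma cl_wirtinger_scalar f z Df Dbf (X : Cl) : wirtinger f z Df Dbf ->
  cl_wirtinger (fun z => f z *: X) z (fun j => Df j *: X) (fun j => Dbf j *: X).
Proof.
move=> wf; apply: cl_wirtinger_eq (cl_wirtingerZ wf (cl_wirtinger_cst X z)) => j;
by rewrite scaler0 addr0.
Qed.

Lemma cl_wirtinger_hvec z :
  cl_wirtinger (@hvec C n) z (fun j => witt C j) (fun=> 0).
Proof.
apply: cl_wirtinger_eq (cl_wirtinger_sum _ (fun i =>
  cl_wirtinger_scalar (witt C i) (wirtinger_coord i z))) => j /=.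
  rewrite (bigD1 j) //= eqxx scale1r big1 ?addr0 // => i /negPf ij.
  by rewrite eq_sym ij scale0r.
by rewrite big1 // => i _; rewrite scale0r.
Qed.

Lemma cl_wirtinger_hvecd z :
  cl_wirtinger (@hvecd C n) z (fun=> 0) (fun j => wittd C j).
Proof.
apply: cl_wirtinger_eq (cl_wirtinger_sum _ (fun i =>
  cl_wirtinger_scalar (wittd C i) (wirtinger_coordJ i z))) => j /=.
  by rewrite big1 // => i _; rewrite scale0r.
rewrite (bigD1 j) //= eqxx scale1r big1 ?addr0 // => i /negPf ij.
by rewrite eq_sym ij scale0r.
Qed.

Lemma wirtinger_rderive g z D Db v : cl_wirtinger g z D Db ->
  rderive v g z = \sum_j (v 0 j *: D j + (v 0 j)^* *: Db j).
Proof.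
move=> w; apply/ffunP => A; rewrite ffunE sum_ffunE.
under eq_bigr do rewrite cl_addE !cl_scaleE.
have [re im] := w A v; rewrite !derive1E.
rewrite (@derive_val _ _ _ _ _ _ _ re) (@derive_val _ _ _ _ _ _ _ im); by case: (\sum_j _).
Qed.

(** Evaluating along e_j and i e_j gives D_j + Db_j and i (D_j - Db_j), from which
the combinations defining the two Wirtinger derivatives recover D_j and Db_j. *)
Lemma cl_wirtingerE g z D Db j : cl_wirtinger g z D Db ->
  dz j g z = D j /\ dzbar j g z = Db j.
Proof.
move=> w.
have E1 : rderive (delta_mx 0 j) g z = D j + Db j.
  rewrite (wirtinger_rderive _ w) (bigD1 j) //= big1 ?addr0 => [|k kj].
    by rewrite !mxE !eqxx /= conjC1 !scale1r.
  by rewrite !mxE eqxx (negPf kj) /= conjC0 !scale0r addr0.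
have E2 : rderive ('i *: delta_mx 0 j) g z = 'i *: (D j - Db j).
  rewrite (wirtinger_rderive _ w) (bigD1 j) //= big1 ?addr0 => [|k kj].
    by rewrite !mxE !eqxx /= mulr1 conjCi scalerBr scaleNr.
  by rewrite !mxE eqxx (negPf kj) /= mulr0 conjC0 !scale0r addr0.
rewrite /dz /dzbar E1 E2 scalerA -expr2 sqrCi scaleN1r opprK.
by split; apply/ffunP => A; rewrite !(cl_addE, cl_scaleE, cl_oppE); field.
Qed.

End CWirtinger.

(** * Normal ordering in the Clifford algebra *)

Section Words.
Variables (C : numClosedFieldType) (n : nat).
Local Notation V := 'rV[C]_n.
Local Notation Cl := (clifford C (n + n)).
Local Notation beta := (cl_beta C n).
Implicit Types (z u v : V) (X Y : Cl).

Lemma anticomm_sum (x y : 'I_n -> C) (f g : 'I_n -> Cl) :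
  (\sum_i x i *: f i) * (\sum_j y j *: g j)
    + (\sum_j y j *: g j) * (\sum_i x i *: f i) =
  \sum_i \sum_j (x i * y j) *: (f i * g j + g j * f i).
Proof.
rewrite !mulr_suml; under eq_bigr do rewrite mulr_sumr.
under [X in _ + X = _]eq_bigr do rewrite mulr_sumr.
rewrite [X in _ + X = _]exchange_big -big_split /=; apply: eq_bigr => i _.
rewrite -big_split /=; apply: eq_bigr => j _.
by rewrite -!scalerAl -!scalerAr !scalerA (mulrC (y j)) -scalerDr.
Qed.

Lemma hvecM z u : hvec z * hvec u = - (hvec u * hvec z).
Proof.
apply/eqP; rewrite -addr_eq0 anticomm_sum; apply/eqP.
by rewrite big1 // => i _; rewrite big1 // => j _; rewrite wittM scaler0.
Qed.

Lemma hvecdM z u : hvecd z * hvecd u = - (hvecd u * hvecd z).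
Proof.
apply/eqP; rewrite -addr_eq0 anticomm_sum; apply/eqP.
by rewrite big1 // => i _; rewrite big1 // => j _; rewrite wittdM scaler0.
Qed.

Lemma hvecd_wittd z j : hvecd z * wittd C j = - (wittd C j * hvecd z).
Proof.
rewrite /hvecd mulr_suml mulr_sumr -sumrN; apply: eq_bigr => i _.
rewrite -scalerAl -scalerAr -scalerN; congr (_ *: _).
by apply/eqP; rewrite -addr_eq0 wittdM.
Qed.

Lemma self_opp0 X : X = - X -> X = 0.
Proof.
move=> E; have : 2 *: X = 0 by rewrite scaler_nat mulr2n {2}E subrr.
by move/(congr1 (fun Y => 2^-1 *: Y)); rewrite scalerA mulVf ?pnatr_eq0 // scale1r scaler0.
Qed.

Lemma hvec_sq z : hvec z * hvec z = 0.
Proof. exact/self_opp0/hvecM. Qed.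

Lemma hvecd_sq z : hvecd z * hvecd z = 0.
Proof. exact/self_opp0/hvecdM. Qed.

Lemma hvecdMhvec u z : hvecd u * hvec z = hip z u *: 1 - hvec z * hvecd u.
Proof.
apply/eqP; rewrite eq_sym subr_eq addrC eq_sym anticomm_sum; apply/eqP.
rewrite /hip scaler_suml; apply: eq_bigr => i _.
rewrite (bigD1 i) //= big1 ?addr0 => [|j ji]; last first.
  by rewrite witt_wittdM eq_sym (negPf ji) scaler0.
by rewrite witt_wittdM eqxx.
Qed.

Lemma sum_witt_wittd : \sum_j witt C j * wittd C j = n%:R *: 1 - beta.
Proof.
apply/eqP; rewrite eq_sym subr_eq -big_split /=; apply/eqP.
under eq_bigr do rewrite witt_wittdM eqxx.
by rewrite sumr_const card_ord scaler_nat.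
Qed.

(** beta counts the daggered vectors: f_j lowers it by one, as only the summand
f_j+ f_j fails to commute with f_j. *)
Lemma witt_beta j : witt C j * beta = beta * witt C j + witt C j.
Proof.
apply/eqP; rewrite addrC -subr_eq; apply/eqP; rewrite /cl_beta mulr_sumr mulr_suml -sumrB.
rewrite (bigD1 j) //= big1 => [|k kj]; last first.
  have := witt_wittdM C k j; rewrite (negPf kj) => /eqP; rewrite addr_eq0 => /eqP E.
  have := wittM C k j => /eqP; rewrite addr_eq0 => /eqP E'.
  have E2: witt C j * wittd C k = - (wittd C k * witt C j).
    by have := witt_wittdM C j k; rewrite eq_sym (negPf kj) => /eqP; rewrite addr_eq0 => /eqP.
  by rewrite mulrA E2 mulNr -!mulrA E' mulrN opprK addNr.
have E : witt C j * witt C j = 0 by apply: self_opp0; apply/eqP; rewrite -addr_eq0 wittM.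
have E2 : wittd C j * witt C j = 1 - witt C j * wittd C j.
  by apply/eqP; rewrite eq_sym subr_eq addrC witt_wittdM eqxx.
by rewrite mulrA -(mulrA (wittd C j)) E mulr0 subr0 -mulrA E2 mulrBr mulr1 mulrA E mul0r subr0 addr0.
Qed.

Lemma hvec_beta z : hvec z * beta = beta * hvec z + hvec z.
Proof.
rewrite /hvec mulr_suml mulr_sumr -big_split /=; apply: eq_bigr => j _.
by rewrite -scalerAl -scalerAr witt_beta scalerDr.
Qed.

End Words.

Section AbstractWords.
Variables (F : comNzRingType) (A : algType F).
Variables (z u zd ud beta : A) (a b r t : F).
Ltac expand := rewrite ?(mulrDl, mulrDr, mulrN, mulNr, mulr1, mul1r) -?scalerAr -?scalerAl -?scalerAr
  ?(mulrDl, mulrDr, mulrN, mulNr, mulr1, mul1r) -?scalerAr -?scalerAl -?scalerAr ?mulrA.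
Ltac lin := lin_split F; ring.

Lemma left_image_words x1 x2 x3 x4 :
  u * (x1 *: ud - x3 *: zd) + z * (- x2 *: ud + x4 *: zd) =
  x1 *: (u * ud) - x2 *: (z * ud) - x3 *: (u * zd) + x4 *: (z * zd).
Proof. by expand; lin. Qed.

Hypothesis zz : z * z = 0.
Hypothesis uu : u * u = 0.
Hypothesis zdzd : zd * zd = 0.
Hypothesis udud : ud * ud = 0.
Hypothesis uz : u * z = - (z * u).
Hypothesis zdud : zd * ud = - (ud * zd).
Hypothesis udz : ud * z = a *: 1 - z * ud.
Hypothesis zdz : zd * z = r *: 1 - z * zd.
Hypothesis udu : ud * u = t *: 1 - u * ud.
Hypothesis zdu : zd * u = b *: 1 - u * zd.
Hypothesis zbeta : z * beta = beta * z + z.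
Hypothesis ubeta : u * beta = beta * u + u.

(** Words are brought to the normal order in which beta stands first, z precedes
u, and the daggered vectors come last.  The words are abstract elements of an
algebra, because rewriting in the concrete Clifford algebra would keep unfolding
its product. *)
Lemma diracd_r_words n x1 x2 x3 x4 x5 y1 y2 y3 y4 y5 e1 e2 :
  (x1 *: (u * ud) - x2 *: (z * ud) - x3 *: (u * zd) + x4 *: (z * zd)
     - x5 *: (n *: 1 - beta)) * z +
  (y1 *: (u * ud) - y2 *: (z * ud) - y3 *: (u * zd) + y4 *: (z * zd)
     - y5 *: (n *: 1 - beta)) * u +
  (e1 *: u - e2 *: z) * beta =
  (x1 * a - x3 * r + y1 * t - y3 * b - n * y5 + e1) *: u
  + (x4 * r - x2 * a - y2 * t + y4 * b - n * x5 - e2) *: z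
  + (y5 + e1) *: (beta * u) + (x5 - e2) *: (beta * z)
  + z * u * ((x1 + y2) *: ud - (x3 + y4) *: zd).
Proof.
expand; rewrite zbeta ubeta.
have word (p q v : A) c : q * v = c *: 1 - v * q -> p * q * v = c *: p - p * v * q.
  by move=> E; rewrite -mulrA E mulrBr -scalerAr mulr1 mulrA.
rewrite !(word _ _ _ _ udz) !(word _ _ _ _ zdz) !(word _ _ _ _ udu) !(word _ _ _ _ zdu).
rewrite uz zz uu !mul0r !mulNr !mul1r.
by lin.
Qed.

(** [diracd_r_words] with the coefficients evaluated: E, m, B and D are those of
[middle_image], and the hypothesis x5 = e2 is the vanishing of the coefficient
of beta z. *)
Lemma middle_words n x1 x2 x3 x4 x5 y1 y2 y3 y4 y5 e1 e2 N p m E B D :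
  x1 * a - x3 * r + y1 * t - y3 * b - n * y5 + e1 = N * (p * E) ->
  x4 * r - x2 * a - y2 * t + y4 * b - n * x5 - e2 = - (N * m) ->
  y5 + e1 = N * E -> x5 = e2 -> x1 + y2 = N * B -> x3 + y4 = N * D ->
  (x1 *: (u * ud) - x2 *: (z * ud) - x3 *: (u * zd) + x4 *: (z * zd)
     - x5 *: (n *: 1 - beta)) * z +
  (y1 *: (u * ud) - y2 *: (z * ud) - y3 *: (u * zd) + y4 *: (z * zd)
     - y5 *: (n *: 1 - beta)) * u +
  (e1 *: u - e2 *: z) * beta =
  N *: (E *: (beta * u + p *: u) - m *: z + B *: (z * u * ud) - D *: (z * u * zd)).
Proof.
move=> cu cz cbu cbz cB cD; rewrite diracd_r_words cu cz cbu cbz cB cD.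
by rewrite !mulrBr -!scalerAr; lin.
Qed.

(** Both sides are normally ordered.  The Euler relation q E = b C - r t D cancels
the scalar terms produced by q, by the two wedge products and by z+ u; the other
hypotheses match the remaining words one by one. *)
Lemma final_words n p q N half E B C D m1 m2 h3 h4 k3 k4 :
  half + half = 1 ->
  q * E = b * C - r * t * D ->
  m1 = t * D * (n - 1 + p) ->
  m2 = (q + 1) * B - N * (b * D) ->
  h3 + k4 = N * D ->
  (C *: (beta * u + p *: u) - m1 *: z + h3 *: (z * u * ud) - h4 *: (z * u * zd)) * zd +
  (- (r * D) *: (beta * u + p *: u) - m2 *: z + k3 *: (z * u * ud) - k4 *: (z * u * zd)) * ud +
  (E *: ((beta + p *: 1) * (n *: 1 - beta))
     - (B *: (z * (n *: 1 - beta) * ud) - (t * D) *: (z * (n *: 1 - beta) * zd))) =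
  E *: ((beta + p *: 1) * (n *: 1 - beta + q *: 1))
  - (t * D) *: ((beta + p *: 1) * (half *: (z * zd - zd * z)))
  - (r * D) *: ((beta + p *: 1) * (half *: (u * ud - ud * u)))
  - C *: ((beta + p *: 1) * (zd * u))
  - B *: ((n *: 1 - beta + q *: 1) * (z * ud))
  + (N * D) *: (z * zd * u * ud).
Proof.
move=> half2 euE -> -> h3k4.
have word (c v w : A) : v * w = - (w * v) -> c * v * w = - (c * w * v).
  by move=> H; rewrite -mulrA H mulrN mulrA.
have word' (c v w : A) d : v * w = d *: 1 - w * v -> c * v * w = d *: c - c * w * v.
  by move=> H; rewrite -mulrA H mulrBr -scalerAr mulr1 mulrA.
have sq (c v : A) : v * v = 0 -> c * v * v = 0 by move=> H; rewrite -mulrA H mulr0.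
(* Writing one of the two halves as 1 - half makes the scalars r t D of both
   wedge products add up without dividing by 2. *)
have halfE : half = 1 - half by rewrite -half2 addrK.
have wedge c (x y : A) : y * x = c *: 1 - x * y ->
    half *: (x * y - y * x) = x * y - (half * c) *: 1.
  move=> ->; transitivity ((half + half) *: (x * y) - (half * c) *: 1); first by lin.
  by rewrite half2 scale1r.
rewrite (wedge _ _ _ zdz) (wedge _ _ _ udu) {2}halfE.
rewrite (_ : z * (n *: 1 - beta) = n *: z - (beta * z + z)); last first.
  by rewrite mulrBr zbeta -scalerAr mulr1.
expand; rewrite !(word' _ _ _ _ zdu) zdu.
expand; rewrite !(word _ _ _ zdud) !(sq _ _ zdzd) !(sq _ _ udud).
expand.
have -> : h3 = N * D - k4 by rewrite -h3k4 addrK.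
have euE' : b * C = q * E + r * t * D by rewrite euE subrK.
by lin_split F; ring: euE'.
Qed.
End AbstractWords.

(** * The Dirac operators on zonal functions *)

Section Assembly.
Variables (F : comNzRingType) (A : algType F) (n : nat).
Implicit Types (f g : 'I_n -> A) (x y : 'I_n -> F) (X Y Z : A).

(** The shape in which gradients occur: combinations of the coordinates of two
vectors, which sum up to those vectors, and a remainder T. *)
Lemma sum_mul_assembly f x y X Y (T : 'I_n -> A) :
  \sum_j f j * (x j *: X + y j *: Y + T j) =
  (\sum_j x j *: f j) * X + (\sum_j y j *: f j) * Y + \sum_j f j * T j.
Proof.
rewrite !mulr_suml -!big_split /=; apply: eq_bigr => j _.
by rewrite !mulrDr -!scalerAr -!scalerAl.
Qed.

Lemma mul_sum_assembly f x y X Y (T : 'I_n -> A) :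
  \sum_j (x j *: X + y j *: Y + T j) * f j =
  X * (\sum_j x j *: f j) + Y * (\sum_j y j *: f j) + \sum_j T j * f j.
Proof.
rewrite !mulr_sumr -!big_split /=; apply: eq_bigr => j _.
by rewrite !mulrDl -!scalerAr -!scalerAl.
Qed.

Lemma sum_scale_mul f g c S : \sum_j f j * g j = S ->
  \sum_j f j * (c *: g j) = c *: S.
Proof.
by move=> <-; rewrite scaler_sumr; apply: eq_bigr => j _; rewrite -scalerAr.
Qed.

Lemma sum_sandwich_diff f g c d X Y S : \sum_j f j * g j = S ->
  \sum_j (c *: (X * f j) - d *: (Y * f j)) * g j = (c *: X - d *: Y) * S.
Proof.
move=> <-; rewrite mulr_sumr; apply: eq_bigr => j _.
by rewrite !mulrBl -!scalerAl !mulrA.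
Qed.

(** Here g_j is moved through Y and Z, with which it anticommutes, to meet f_j. *)
Lemma sum_sandwich_anti f g e b d c B X Y Z S : \sum_j f j * g j = S ->
  (forall j, Y * g j = - (g j * Y)) -> (forall j, Z * g j = - (g j * Z)) ->
  \sum_j (e *: (B * f j + c *: f j) + b *: (X * f j * Y) - d *: (X * f j * Z)) * g j =
  e *: ((B + c *: 1) * S) - (b *: (X * S * Y) - d *: (X * S * Z)).
Proof.
move=> <- Yg Zg; rewrite !(mulr_sumr, mulr_suml) !scaler_sumr -!sumrB.
apply: eq_bigr => j _.
have anti W : W * g j = - (g j * W) -> X * f j * W * g j = - (X * (f j * g j) * W).
  by move=> E; rewrite -(mulrA _ W) E mulrN !mulrA.
rewrite mulrBl !mulrDl -!scalerAl mulrDl -scalerAl (anti _ (Yg j)) (anti _ (Zg j)).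
by rewrite mul1r !mulrA; lin_split F; ring.
Qed.
End Assembly.

Section Steps.
Variables (R : realType) (n : nat).
Local Notation C := R[i].
Local Notation V := 'rV[C]_n.
Local Notation Cl := (clifford C (n + n)).
Local Notation beta := (cl_beta C n).
Implicit Types (z u : V) (l : nat) (P Q : int).

Definition hzonal l P Q z u : C :=
  zonal l P Q (hip z u) (hip u z) (hip z z * hip u u).

Ltac scalar_ring :=
  repeat match goal with
  | |- context [hzonal ?l ?P ?Q ?z ?u] => generalize (hzonal l P Q z u); intro
  | |- context [hip ?z ?u] => generalize (hip z u); intro
  end; ring.

Ltac cl_ring := lin_split R[i]; scalar_ring.

Lemma wirtinger_hzonal_l l P Q z u :
  wirtinger (fun z => hzonal l P Q z u) z
    (fun j => hzonal l.+1 (P - 1) Q z u * (u 0 j)^*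
       - hzonal l.+1 (P - 1) (Q - 1) z u * hip u u * (z 0 j)^*)
    (fun j => hzonal l.+1 P (Q - 1) z u * u 0 j
       - hzonal l.+1 (P - 1) (Q - 1) z u * hip u u * z 0 j).
Proof.
have := wirtinger_zonal l P Q (wirtinger_hipl u z) (wirtinger_hipr u z)
  (wirtingerM (wirtinger_hip_sq z) (wirtinger_cst (hip u u) z)).
by apply: wirtinger_eq => j; rewrite /hzonal; ring.
Qed.

Lemma wirtinger_hzonal_r l P Q z u :
  wirtinger (hzonal l P Q z) u
    (fun j => hzonal l.+1 P (Q - 1) z u * (z 0 j)^*
       - hzonal l.+1 (P - 1) (Q - 1) z u * hip z z * (u 0 j)^*)
    (fun j => hzonal l.+1 (P - 1) Q z u * z 0 j
       - hzonal l.+1 (P - 1) (Q - 1) z u * hip z z * u 0 j).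
Proof.
have := wirtinger_zonal l P Q (wirtinger_hipr z u) (wirtinger_hipl z u)
  (wirtingerM (wirtinger_cst (hip z z) u) (wirtinger_hip_sq u)).
by apply: wirtinger_eq => j; rewrite /hzonal; ring.
Qed.

Lemma dirac_lE g z D Db (X Y : Cl) (x y : V) : cl_wirtinger g z D Db ->
  (forall j, D j = (x 0 j)^* *: X + (y 0 j)^* *: Y) ->
  dirac_l g z = hvecd x * X + hvecd y * Y.
Proof.
move=> w E; have := sum_mul_assembly (@wittd C n)
  (fun j : 'I_n => (x 0 j)^*) (fun j => (y 0 j)^*) X Y (fun=> 0).
rewrite [X in _ + X]big1 => [|j _]; last by rewrite mulr0.
rewrite addr0 => <-; apply: eq_bigr => j _.
by rewrite (cl_wirtingerE j w).1 E addr0.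
Qed.

Lemma diracd_lE g z D Db (X Y : Cl) (T : 'I_n -> Cl) (x y : V) :
  cl_wirtinger g z D Db ->
  (forall j, Db j = x 0 j *: X + y 0 j *: Y + T j) ->
  diracd_l g z = hvec x * X + hvec y * Y + \sum_j witt C j * T j.
Proof.
move=> w E; rewrite -sum_mul_assembly; apply: eq_bigr => j _.
by rewrite (cl_wirtingerE j w).2 E.
Qed.

Lemma diracd_rE g z D Db (X Y : Cl) (T : 'I_n -> Cl) (x y : V) :
  cl_wirtinger g z D Db ->
  (forall j, Db j = x 0 j *: X + y 0 j *: Y + T j) ->
  diracd_r g z = X * hvec x + Y * hvec y + \sum_j T j * witt C j.
Proof.
move=> w E; rewrite -mul_sum_assembly; apply: eq_bigr => j _.
by rewrite (cl_wirtingerE j w).2 E.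
Qed.

Lemma dirac_rE g z D Db (X Y : Cl) (T : 'I_n -> Cl) (x y : V) :
  cl_wirtinger g z D Db ->
  (forall j, D j = (x 0 j)^* *: X + (y 0 j)^* *: Y + T j) ->
  dirac_r g z = X * hvecd x + Y * hvecd y + \sum_j T j * wittd C j.
Proof.
move=> w E; rewrite -mul_sum_assembly; apply: eq_bigr => j _.
by rewrite (cl_wirtingerE j w).1 E.
Qed.

Lemma cl_wirtinger_scaleE c g z D Db j : cl_wirtinger g z D Db ->
  dz j (fun z => c *: g z) z = c *: dz j g z /\
  dzbar j (fun z => c *: g z) z = c *: dzbar j g z.
Proof.
move=> w; have [-> ->] := cl_wirtingerE j (cl_wirtingerZ (wirtinger_cst c z) w).
by have [-> ->] := cl_wirtingerE j w; rewrite !scale0r !add0r.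
Qed.

(** Differentiability is needed: c is complex, so it mixes the real and imaginary
parts on which the derivatives are taken separately. *)
Lemma dirac_lZ c g z D Db : cl_wirtinger g z D Db ->
  dirac_l (fun z => c *: g z) z = c *: dirac_l g z.
Proof.
move=> w; rewrite /dirac_l scaler_sumr; apply: eq_bigr => j _.
by rewrite (cl_wirtinger_scaleE c j w).1 scalerAr.
Qed.

Lemma diracd_lZ c g z D Db : cl_wirtinger g z D Db ->
  diracd_l (fun z => c *: g z) z = c *: diracd_l g z.
Proof.
move=> w; rewrite /diracd_l scaler_sumr; apply: eq_bigr => j _.
by rewrite (cl_wirtinger_scaleE c j w).2 scalerAr.
Qed.

Lemma dirac_rZ c g z D Db : cl_wirtinger g z D Db ->
  dirac_r (fun z => c *: g z) z = c *: dirac_r g z.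
Proof.
move=> w; rewrite /dirac_r scaler_sumr; apply: eq_bigr => j _.
by rewrite (cl_wirtinger_scaleE c j w).1 scalerAl.
Qed.

Lemma diracd_rZ c g z D Db : cl_wirtinger g z D Db ->
  diracd_r (fun z => c *: g z) z = c *: diracd_r g z.
Proof.
move=> w; rewrite /diracd_r scaler_sumr; apply: eq_bigr => j _.
by rewrite (cl_wirtinger_scaleE c j w).2 scalerAl.
Qed.

(** The image of the scalar kernel under the two operators in z, with the kernel
of index l - 1 and bidegree (P + 1, Q + 1). *)
Definition left_image l P Q z u : Cl :=
  hzonal l.+1 P Q z u *: (hvec u * hvecd u)
  - (hip u u * hzonal l.+1 (P - 1) Q z u) *: (hvec z * hvecd u)
  - (hip u u * hzonal l.+1 P (Q - 1) z u) *: (hvec u * hvecd z)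
  + (hip u u ^+ 2 * hzonal l.+1 (P - 1) (Q - 1) z u) *: (hvec z * hvecd z)
  - (hip u u * hzonal l P Q z u) *: (n%:R *: 1 - beta).

Lemma dirac_l_zonal c l P Q z u :
  dirac_l (fun z => c *: (hzonal l P Q z u)%:A) z =
  c *: (hzonal l.+1 (P - 1) Q z u *: hvecd u
        - (hip u u * hzonal l.+1 (P - 1) (Q - 1) z u) *: hvecd z).
Proof.
have w := cl_wirtinger_scalar (1 : Cl) (wirtinger_hzonal_l l P Q z u).
rewrite (dirac_lZ c w); congr (_ *: _).
rewrite (dirac_lE (x := u) (y := z) (X := (hzonal l.+1 (P - 1) Q z u)%:A)
  (Y := (- (hip u u * hzonal l.+1 (P - 1) (Q - 1) z u))%:A) w) => [|j].
  by rewrite !mulr_algr scaleNr.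
by cl_ring.
Qed.

Lemma left_image_hzonal c l P Q z u :
  diracd_l (dirac_l (fun z => c *: (hzonal l P Q z u)%:A)) z =
  c *: left_image l.+1 (P - 1) (Q - 1) z u.
Proof.
under [dirac_l _]boolp.funext => y do rewrite dirac_l_zonal.
have w := cl_wirtingerB
  (cl_wirtinger_scalar (hvecd u) (wirtinger_hzonal_l l.+1 (P - 1) Q z u))
  (cl_wirtingerZ (wirtingerM (wirtinger_cst (hip u u) z)
    (wirtinger_hzonal_l l.+1 (P - 1) (Q - 1) z u)) (cl_wirtinger_hvecd z)).
rewrite (diracd_lZ c w); congr (_ *: _); pose t := hip u u.
rewrite (diracd_lE (x := u) (y := z)
  (X := hzonal l.+2 (P - 1) (Q - 1) z u *: hvecd u
      - (t * hzonal l.+2 (P - 1) (Q - 1 - 1) z u) *: hvecd z)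
  (Y := - (t * hzonal l.+2 (P - 1 - 1) (Q - 1) z u) *: hvecd u
      + (t ^+ 2 * hzonal l.+2 (P - 1 - 1) (Q - 1 - 1) z u) *: hvecd z)
  (T := fun j => - (t * hzonal l.+1 (P - 1) (Q - 1) z u) *: wittd C j) w) => [|j].
  by rewrite (sum_scale_mul _ (sum_witt_wittd C n)) left_image_words scaleNr.
by rewrite /t; cl_ring.
Qed.

(** The image of [left_image] under the first operator in u, up to the factor
l + 2 + P + Q. *)
Definition middle_image l P Q z u : Cl :=
  hzonal l P Q z u *: (beta * hvec u + P%:~R *: hvec u)
  - (hip u u * (l%:Z + P)%:~R * hzonal l (P - 1) Q z u) *: hvec z
  + hzonal l.+1 (P - 1) Q z u *: (hvec z * hvec u * hvecd u)
  - (hip u u * hzonal l.+1 (P - 1) (Q - 1) z u) *: (hvec z * hvec u * hvecd z).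

Lemma cl_wirtinger_hvecM X z :
  cl_wirtinger (fun z => hvec z * X) z (fun j => witt C j * X) (fun=> 0).
Proof.
by apply: cl_wirtinger_eq (cl_wirtingerM (cl_wirtinger_hvec z) (cl_wirtinger_cst X z)) => j;
  rewrite mulr0 addr0 ?mul0r.
Qed.

Lemma cl_wirtinger_Mhvecd X z :
  cl_wirtinger (fun z => X * hvecd z) z (fun=> 0) (fun j => X * wittd C j).
Proof.
by apply: cl_wirtinger_eq (cl_wirtingerM (cl_wirtinger_cst X z) (cl_wirtinger_hvecd z)) => j;
  rewrite mul0r add0r ?mulr0.
Qed.

Lemma cl_wirtinger_hvecMhvecd z :
  cl_wirtinger (fun z => hvec z * hvecd z) z
    (fun j => witt C j * hvecd z) (fun j => hvec z * wittd C j).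
Proof.
by apply: cl_wirtinger_eq (cl_wirtingerM (cl_wirtinger_hvec z) (cl_wirtinger_hvecd z)) => j;
  rewrite ?mulr0 ?mul0r ?add0r ?addr0.
Qed.

(** The assumption n = l + 1 links the index of the zonal functions to the
dimension, which enters through the sum of all f_j f_j+, equal to n - beta; only
then does the factor split off. *)
Lemma diracd_r_left_image c l P Q z u : n = l.+1 ->
  diracd_r (fun u => c *: left_image l P Q z u) u =
  (c * (l.+2%:Z + P + Q)%:~R) *: middle_image l P Q z u.
Proof.
move=> nE.
have ws k P' Q' := wirtinger_hzonal_r k P' Q' z u.
have wt := wirtinger_hip_sq u.
(* The gradient of the five words of left_image, in their order. *)
have w := cl_wirtingerB (cl_wirtingerD (cl_wirtingerB (cl_wirtingerB
  (cl_wirtingerZ (ws l.+1 P Q) (cl_wirtinger_hvecMhvecd u))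
  (cl_wirtingerZ (wirtingerM wt (ws l.+1 (P - 1) Q)) (cl_wirtinger_Mhvecd (hvec z) u)))
  (cl_wirtingerZ (wirtingerM wt (ws l.+1 P (Q - 1))) (cl_wirtinger_hvecM (hvecd z) u)))
  (cl_wirtinger_scalar (hvec z * hvecd z)
    (wirtingerM (wirtingerM wt wt) (ws l.+1 (P - 1) (Q - 1)))))
  (cl_wirtinger_scalar (n%:R *: 1 - beta) (wirtingerM wt (ws l P Q))).
rewrite /left_image (diracd_rZ c w) -[RHS]scalerA; congr (_ *: _).
pose r := hip z z; pose t := hip u u; pose a := hip z u; pose b := hip u z.
pose H i j := hzonal l.+2 i j z u.
pose S i j := hzonal l.+1 i j z u.
rewrite (diracd_rE (x := z) (y := u)
  (X := H (P - 1) Q *: (hvec u * hvecd u) - (t * H (P - 1 - 1) Q) *: (hvec z * hvecd u)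
     - (t * H (P - 1) (Q - 1)) *: (hvec u * hvecd z)
     + (t ^+ 2 * H (P - 1 - 1) (Q - 1)) *: (hvec z * hvecd z)
     - (t * S (P - 1) Q) *: (n%:R *: 1 - beta))
  (Y := (- (r * H (P - 1) (Q - 1))) *: (hvec u * hvecd u)
     - (S (P - 1) Q - r * t * H (P - 1 - 1) (Q - 1)) *: (hvec z * hvecd u)
     - (S P (Q - 1) - r * t * H (P - 1) (Q - 1 - 1)) *: (hvec u * hvecd z)
     + (2 * t * S (P - 1) (Q - 1) - r * t ^+ 2 * H (P - 1 - 1) (Q - 1 - 1))
          *: (hvec z * hvecd z)
     - (hzonal l P Q z u - r * t * S (P - 1) (Q - 1)) *: (n%:R *: 1 - beta))
  (T := fun j => S P Q *: (hvec u * wittd C j)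
     - (t * S (P - 1) Q) *: (hvec z * wittd C j)) w) => [|j]; last first.
  by rewrite /H /S /r /t; cl_ring.
rewrite (sum_sandwich_diff _ _ _ _ (erefl _)) -/(cl_beta C n).
have nR : n%:R = l.+1%:R :> C by rewrite nE.
have r1 (x y : V) : hvecd y * hvec x = hip x y *: 1 - hvec x * hvecd y.
  exact: hvecdMhvec.
apply: (middle_words (hvec_sq z) (hvec_sq u) (hvecM u z) (r1 z u) (r1 z z)
  (r1 u u) (r1 u z) (hvec_beta z) (hvec_beta u)).
- by rewrite nR -middle_u /H /S /hzonal -/a -/b -/r -/t; zonal_ring.
- apply: etrans (etrans (congr1 ( *%R t) (middle_z l P Q a b (r * t))) _);
    by rewrite ?nR /H /S /hzonal -/a -/b -/r -/t; zonal_ring.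
- by rewrite -middle_beta_u /H /S /hzonal -/a -/b -/r -/t; zonal_ring.
- by [].
- by rewrite -middle_zuud /H /S /hzonal -/a -/b -/r -/t; zonal_ring.
- apply: etrans (etrans (congr1 ( *%R t) (middle_zuzd l P Q a b (r * t))) _);
    by rewrite /H /S /hzonal -/a -/b -/r -/t; zonal_ring.
Qed.

(** The formula of the theorem before its coefficients are rewritten with Jacobi
polynomials. *)
Lemma dirac_r_middle_image c l P Q z u : n = l.+1 ->
  dirac_r (fun u => c *: middle_image l P Q z u) u = c *: (
  hzonal l P Q z u *: ((beta + P%:~R *: 1) * (n%:R *: 1 - beta + Q%:~R *: 1))
  - (hip u u * hzonal l.+1 (P - 1) (Q - 1) z u) *:
      ((beta + P%:~R *: 1) * cl_wedge (hvec z) (hvecd z))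
  - (hip z z * hzonal l.+1 (P - 1) (Q - 1) z u) *:
      ((beta + P%:~R *: 1) * cl_wedge (hvec u) (hvecd u))
  - hzonal l.+1 P (Q - 1) z u *: ((beta + P%:~R *: 1) * (hvecd z * hvec u))
  - hzonal l.+1 (P - 1) Q z u *:
      ((n%:R *: 1 - beta + Q%:~R *: 1) * (hvec z * hvecd u))
  + ((l.+1%:Z + P + Q)%:~R * hzonal l.+1 (P - 1) (Q - 1) z u) *:
      (hvec z * hvecd z * hvec u * hvecd u)).
Proof.
move=> nE; have nR : n%:R = l.+1%:R :> C by rewrite nE.
have ws k P' Q' := wirtinger_hzonal_r k P' Q' z u.
have wt := wirtinger_hip_sq u.
have wu : cl_wirtinger (fun u => beta * hvec u + P%:~R *: hvec u) u
    (fun j => beta * witt C j + P%:~R *: witt C j) (fun=> 0).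
  by apply: cl_wirtinger_eq (cl_wirtingerD
    (cl_wirtingerM (cl_wirtinger_cst beta u) (cl_wirtinger_hvec u))
    (cl_wirtingerZ (wirtinger_cst P%:~R u) (cl_wirtinger_hvec u))) => j;
    rewrite !(mul0r, mulr0, scale0r, scaler0, add0r).
have wzuud : cl_wirtinger (fun u => hvec z * hvec u * hvecd u) u
    (fun j => hvec z * witt C j * hvecd u) (fun j => hvec z * hvec u * wittd C j).
  under [fun u => _]boolp.funext => y do rewrite -mulrA.
  by apply: cl_wirtinger_eq (cl_wirtingerM (cl_wirtinger_cst (hvec z) u)
    (cl_wirtinger_hvecMhvecd u)) => j; rewrite mul0r add0r mulrA.
have wzuzd : cl_wirtinger (fun u => hvec z * hvec u * hvecd z) u
    (fun j => hvec z * witt C j * hvecd z) (fun=> 0).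
  under [fun u => _]boolp.funext => y do rewrite -mulrA.
  by apply: cl_wirtinger_eq (cl_wirtingerM (cl_wirtinger_cst (hvec z) u)
    (cl_wirtinger_hvecM (hvecd z) u)) => j; rewrite mul0r add0r ?mulr0 ?mulrA.
have w := cl_wirtingerB (cl_wirtingerD (cl_wirtingerB (cl_wirtingerZ (ws l P Q) wu)
    (cl_wirtinger_scalar (hvec z) (wirtingerM (wirtingerM wt
      (wirtinger_cst (l%:Z + P)%:~R u)) (ws l (P - 1) Q))))
  (cl_wirtingerZ (ws l.+1 (P - 1) Q) wzuud))
  (cl_wirtingerZ (wirtingerM wt (ws l.+1 (P - 1) (Q - 1))) wzuzd).
rewrite /middle_image (dirac_rZ c w); congr (_ *: _).
pose r := hip z z; pose t := hip u u; pose a := hip z u; pose b := hip u z.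
pose H i j := hzonal l.+2 i j z u.
pose S i j := hzonal l.+1 i j z u.
pose G i j := hzonal l i j z u.
rewrite (dirac_rE (x := z) (y := u)
  (X := S P (Q - 1) *: (beta * hvec u + P%:~R *: hvec u)
     - (t * (l%:Z + P)%:~R * S (P - 1) (Q - 1)) *: hvec z
     + H (P - 1) (Q - 1) *: (hvec z * hvec u * hvecd u)
     - (t * H (P - 1) (Q - 1 - 1)) *: (hvec z * hvec u * hvecd z))
  (Y := - (r * S (P - 1) (Q - 1)) *: (beta * hvec u + P%:~R *: hvec u)
     - ((l%:Z + P)%:~R * (G (P - 1) Q - r * t * S (P - 1 - 1) (Q - 1))) *: hvec z
     + - (r * H (P - 1 - 1) (Q - 1)) *: (hvec z * hvec u * hvecd u)
     - (S (P - 1) (Q - 1) - r * t * H (P - 1 - 1) (Q - 1 - 1))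
          *: (hvec z * hvec u * hvecd z))
  (T := fun j => G P Q *: (beta * witt C j + P%:~R *: witt C j)
     + S (P - 1) Q *: (hvec z * witt C j * hvecd u)
     - (t * S (P - 1) (Q - 1)) *: (hvec z * witt C j * hvecd z)) w) => [|j]; last first.
  by rewrite /H /S /G /r /t; cl_ring.
rewrite (sum_sandwich_anti _ _ _ _ _ _ (sum_witt_wittd C n)
  (hvecd_wittd u) (hvecd_wittd z)).
have r1 (x y : V) : hvecd y * hvec x = hip x y *: 1 - hvec x * hvecd y.
  exact: hvecdMhvec.
apply: (final_words (hvecd_sq z) (hvecd_sq u) (hvecdM z u) (r1 z z)
  (r1 u u) (r1 u z) (hvec_beta z)).
- by field.
- exact: zonal_eulerr.
- by rewrite nR /t; ring.
- exact: final_zud.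
- exact: final_zuudzd.
Qed.
End Steps.

(** * From the zonal formula to Jacobi polynomials *)

Section Hip.
Variables (C : numClosedFieldType) (n : nat).
Implicit Types (z u : 'rV[C]_n).
Lemma hipC z u : (hip z u)^* = hip u z.
Proof.
rewrite /hip rmorph_sum; apply: eq_bigr => j _.
by rewrite rmorphM /= conjCK mulrC.
Qed.

Lemma hip_sq_eq0 z : hip z z = 0 -> z = 0.
Proof.
move/eqP; rewrite psumr_eq0 => [/allP z0|j _]; last exact: mul_conjC_ge0.
apply/rowP => j; have := z0 j (mem_index_enum j).
by rewrite mul_conjC_eq0 mxE => /eqP.
Qed.

Lemma hip_norm_eq0 z u : hip z z * hip u u = 0 -> hip z u = 0.
Proof.
move/eqP; rewrite mulf_eq0 => /orP[] /eqP/hip_sq_eq0->; rewrite /hip big1 // => j _.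
  by rewrite mxE mul0r.
by rewrite mxE conjC0 mulr0.
Qed.
End Hip.

Section Final.
Variables (R : realType) (n : nat).
Implicit Types (z u : 'rV[R[i]]_n).

Lemma jacobi_hzonal k A B z u : (0 < B + k)%N ->
  hip z u ^+ B * (hip z z ^+ k * hip u u ^+ k) * jacobi k A B (2 * hip_s z u - 1) =
  (B + k)`!%:R / (A + B + k)`!%:R * hzonal A (B + k)%N k z u.
Proof.
move=> Bk; rewrite -exprMn /hip_s hipC jacobi_zonal //.
exact: hip_norm_eq0.
Qed.

(** For p > 0 this holds also where z or u vanishes. *)
Lemma hkernel_hzonal p q z u : (q <= p)%N -> (0 < p)%N ->
  hkernel p q z u =
  kernel_cst R[i] n p q * (p`!%:R / (n - 2 + p)`!%:R) * hzonal (n - 2) p q z u.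
Proof.
move=> le_qp p0; have := @jacobi_hzonal q (n - 2) (p - q) z u.
rewrite -addnA subnK // => /(_ p0) E.
by rewrite -[RHS]mulrA -E /hkernel; ring.
Qed.

End Final.

Lemma six_terms (F : comNzRingType) (V : lmodType F) (K L : F) (x1 x2 x3 x4 x5 x6 y1 y2 y3 y4 y5 y6 : F) (W1 W2 W3 W4 W5 W6 : V) :
  K * x1 = L * y1 -> K * x2 = L * y2 -> K * x3 = L * y3 ->
  K * x4 = L * y4 -> K * x5 = L * y5 -> K * x6 = L * y6 ->
  K *: (x1 *: W1 - x2 *: W2 - x3 *: W3 - x4 *: W4 - x5 *: W5 + x6 *: W6) =
  L *: (y1 *: W1 - y2 *: W2 - y3 *: W3 - y4 *: W4 - y5 *: W5 + y6 *: W6).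
Proof.
by move=> *; rewrite !(scalerDr, scalerN) !scalerA; congr (_ - _ - _ - _ - _ + _);
  congr (_ *: _).
Qed.

Theorem theorem4p1 (R : realType) (n p q : nat)
    (n_ge2 : (2 <= n)%N) (q_ge1 : (1 <= q)%N) (lt_qp : (q < p)%N)
    (z u : 'rV[R[i]]_n) :
  let P k a b := jacobi k a b (2 * hip_s z u - 1) in
  let beta := cl_beta R[i] n in
  dirac_r (diracd_r (fun u' =>
    diracd_l (dirac_l (fun z' => (hkernel p.+1 q.+1 z' u')%:A)) z)) u =
  (kernel_cst R[i] n p.+1 q.+1 * p.+1%:R * (n + p + q + 1)%:R *
     hip z u ^+ (p - q - 1) * hip z z ^+ (q - 1) * hip u u ^+ (q - 1)) *:
  ( (hip z u * hip z z * hip u u * P q (n - 1)%N (p - q)%N) *: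
      ((beta + p%:R) * (n%:R - beta + q%:R))
  - (hip z u * hip u u * p%:R * P (q - 1)%N n (p - q)%N) *:
      ((beta + p%:R) * cl_wedge (hvec z) (hvecd z))
  - (hip z u * hip z z * p%:R * P (q - 1)%N n (p - q)%N) *:
      ((beta + p%:R) * cl_wedge (hvec u) (hvecd u))
  - (hip z u ^+ 2 * (n + p)%:R * P (q - 1)%N n (p - q + 1)%N) *:
      ((beta + p%:R) * (hvecd z * hvec u))
  - (hip z z * hip u u * p%:R * P q n (p - q - 1)%N) *:
      ((n%:R - beta + q%:R) * (hvec z * hvecd u))
  + (hip z u * p%:R * (n + p + q)%:R * P (q - 1)%N n (p - q)%N) *:
      (hvec z * hvecd z * hvec u * hvecd u)).
Proof.
move=> P beta.
pose kappa := kernel_cst R[i] n p.+1 q.+1 * (p.+1`!%:R / (n - 2 + p.+1)`!%:R).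
have E1 (u' : 'rV_n) : (fun z' => (hkernel p.+1 q.+1 z' u')%:A : clifford R[i] (n + n)) =
   fun z' => kappa *: (hzonal (n - 2) p.+1 q.+1 z' u')%:A.
  by apply/boolp.funext => z'; rewrite hkernel_hzonal ?ltnS ?scalerA // ltnW.
under [fun u' => _]boolp.funext => u' do rewrite E1 left_image_hzonal.
have -> : p.+1%:Z - 1 = p by lia.
have -> : q.+1%:Z - 1 = q by lia.
have nE : n = (n - 2).+2 by lia.
under [diracd_r _]boolp.funext => u' do rewrite (diracd_r_left_image _ _ _ _ _ nE).
rewrite (dirac_r_middle_image _ _ _ _ _ nE).
rewrite -!(scaler_nat _ (1 : clifford R[i] (n + n))).
have fN (k : nat) : k`!%:R != 0 :> R[i] by rewrite pnatr_eq0 -lt0n fact_gt0.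
rewrite /kappa {kappa E1} /P {P} /beta {beta}.
have [m nm] : exists m, n = m.+2 by exists (n - 2)%N; lia.
have [q' qq] : exists q', q = q'.+1 by exists q.-1; lia.
have [d pd] : exists d, p = (q' + d).+2 by exists (p - q.+1)%N; lia.
have -> : (n - 2 = m)%N by lia.
have Jp := @jacobi_hzonal R n.
(* With q = q' + 1 and p = q + d + 1, the four Jacobi polynomials of the formula
   are the zonal values E, D, C and B. *)
have J1 := Jp q m.+1 d.+1 z u; have J2 := Jp q' m.+2 d.+1 z u.
have J4 := Jp q' m.+2 d.+2 z u; have J5 := Jp q m.+2 d z u.
have -> : (n - 1 = m.+1)%N by lia.
have -> : (p - q = d.+1)%N by lia.
have -> : (d.+1 - 1 = d)%N by lia.
have -> : (q - 1 = q')%N by lia.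
have -> : (d.+1 + 1 = d.+2)%N by lia.
have -> : p%:Z - 1 = (q' + d).+1%:Z by lia.
have -> : q%:Z - 1 = q'%:Z by lia.
move: J1 J2 J4 J5.
have -> : (d.+1 + q = p)%N by lia.
have -> : (d.+1 + q' = (q' + d).+1)%N by lia.
have -> : (d.+2 + q' = p)%N by lia.
have -> : (d + q = (q' + d).+1)%N by lia.
have -> : (m.+1 + d.+1 + q = m + p.+1)%N by lia.
have -> : (m.+2 + d.+1 + q' = m + p.+1)%N by lia.
have -> : (m.+2 + d.+2 + q' = (m + p.+1).+1)%N by lia.
have -> : (m.+2 + d + q = m + p.+1)%N by lia.
move=> /(_ ltac:(lia)) J1 /(_ ltac:(lia)) J2 /(_ ltac:(lia)) J4 /(_ ltac:(lia)) J5.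

have jn k B x : jacobi k n B x = jacobi k m.+2 B x :> R[i] by rewrite nm.
have xq (x : R[i]) : x ^+ q = x * x ^+ q' by rewrite qq exprS.
have fp : p`!%:R = p%:R * (q' + d).+1`!%:R :> R[i] by rewrite pd factS natrM.
rewrite !xq in J1 J5; rewrite !jn.
have fm : (m + p.+1).+1`!%:R = (m%:R + p%:R + 2) * (m + p.+1)`!%:R :> R[i].
  by rewrite factS natrM -natr1 natrD -natr1; ring.
have mp0 : m%:R + p%:R + 2 != 0 :> R[i] by rewrite -!natrD pnatr_eq0 addn2.
have F0 := fN (m + p.+1)%N.
rewrite fm in J4.
pose c : R[i] := kernel_cst R[i] n p.+1 q.+1 * p.+1%:R * (n + p + q + 1)%:R.
rewrite -/c.
(* The constant of the kernel combines with N into the constant of the theorem,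
   up to the factor p! / (n + p - 1)! absorbed by the Jacobi polynomials. *)
have cE : kernel_cst R[i] n p.+1 q.+1 * (p.+1`!%:R / (m + p.+1)`!%:R) *
    (m.+3%:Z + p + q)%:~R = c * (p`!%:R / (m + p.+1)`!%:R).
  rewrite /c factS natrM.
  have -> : (n + p + q + 1)%:R = m%:R + 3 + p%:R + q%:R :> R[i] by rewrite nm; ring.
  by field.
rewrite cE; move: c {cE} => c.
move: J1 J2 J4 J5.
generalize (hip z u) (hip z z) (hip u u) => a r t.
generalize (hzonal m.+1 p q z u) (hzonal m.+2 (q' + d).+1 q' z u)
  (hzonal m.+2 p q' z u) (hzonal m.+2 (q' + d).+1 q z u) => Z1 Z2 Z4 Z5.
set j1 := jacobi q m.+1 _ _; set j2 := jacobi q' m.+2 d.+1 _.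
set j4 := jacobi q' m.+2 d.+2 _; set j5 := jacobi q m.+2 d _.
move: j1 j2 j4 j5 => j1 j2 j4 j5; rewrite !exprS => J1 J2 J4 J5.
have nR : (n + p)%:R = m%:R + p%:R + 2 :> R[i] by rewrite nm; ring.
have nR' : (n + p + q)%:R = (m.+2%:Z + p + q)%:~R :> R[i] by rewrite nm; ring.
apply: six_terms.
- by apply: etrans (etrans (congr1 ( *%R c) (esym J1)) _); [field|ring].
- apply: etrans (etrans (congr1 ( *%R (c * p%:R * t)) (esym J2)) _); last by ring.
  by rewrite fp; field.
- apply: etrans (etrans (congr1 ( *%R (c * p%:R * r)) (esym J2)) _); last by ring.
  by rewrite fp; field.
- apply: etrans (etrans (congr1 ( *%R (c * (n + p)%:R)) (esym J4)) _); last by ring.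
  by rewrite nR; field; rewrite F0 mp0.
- apply: etrans (etrans (congr1 ( *%R (c * p%:R)) (esym J5)) _); last by ring.
  by rewrite fp; field.
- apply: etrans (etrans (congr1 ( *%R (c * p%:R * (n + p + q)%:R)) (esym J2)) _);
    last by ring.
  by rewrite fp nR'; field.
Qed.
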